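(* Let $\Pi_{\mathsf{bssPMT}}$, $\mathcal{F}_{\mathsf{bssPMT}}$, $\mathcal{F}_{\mathsf{bOPPRF}}$ and $\mathcal{F}_{\mathsf{ssPEQT}}$ be the two-party protocol and the ideal functionalities defined in the context, with batch size $B$, element length $l$ and OPPRF output length $\gamma \ge \sigma + \log_2 B$. Then the protocol $\Pi_{\mathsf{bssPMT}}$ securely realizes $\mathcal{F}_{\mathsf{bssPMT}}$ (against semi-honest adversaries) in the $(\mathcal{F}_{\mathsf{bOPPRF}},\mathcal{F}_{\mathsf{ssPEQT}})$-hybrid model.
   Context: $\lambda$ and $\sigma$ are the computational and statistical security parameters; all sizes are polynomial in them. $[B]=\{1,\dots,B\}$, and $X(j)$ denotes the $j$-th element of $X$. There are two parties, a sender $\mathcal{S}$ and a receiver $\mathcal{R}$. **Functionality $\mathcal{F}_{\mathsf{bssPMT}}$** (batch secret-shared private membership test). $\mathcal{S}$ inputs $B$ pairwise disjoint sets $X_1,\dots,X_B\subseteq\{0,1\}^l$; $\mathcal{R}$ inputs $\vec{x}=(x_1,\dots,x_B)\in(\{0,1\}^l)^B$. For each $i\in[B]$ sample two random bits $e_S^i,e_R^i$ subject to $e_S^i\oplus e_R^i=1$ if $x_i\in X_i$ and $e_S^i\oplus e_R^i=0$ otherwise. Give $\vec e_S=(e_S^1,\dots,e_S^B)$ to $\mathcal{S}$ and $\vec e_R=(e_R^1,\dots,e_R^B)$ to $\mathcal{R}$. **Functionality $\mathcal{F}_{\mathsf{bOPPRF}}$** (batch oblivious programmable PRF). $\mathcal{S}$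 inputs pairwise disjoint key sets $K_1,\dots,K_B\subseteq\{0,1\}^l$ and value (multi)sets $V_1,\dots,V_B$ of elements of $\{0,1\}^\gamma$ with $|K_i|=|V_i|$; $\mathcal{R}$ inputs $\vec{x}\in(\{0,1\}^l)^B$. The functionality chooses a uniform key $k_i$ for each $i\in[B]$, samples a programmable PRF $F:\{0,1\}^*\times\{0,1\}^l\to\{0,1\}^\gamma$ with $F(k_i,K_i(j))=V_i(j)$ for all $i\in[B]$, $1\le j\le|K_i|$, and gives $\vec f=(f_1,\dots,f_B)$ with $f_i=F(k_i,x_i)$ to $\mathcal{R}$. A programmable PRF takes the programmed values on the programmed inputs and pseudorandom values (computationally indistinguishable from independent uniform values in $\{0,1\}^\gamma$) on all other inputs. When the programmed values are uniform, $\mathcal{R}$ cannot tell whether a received output is programmed or pseudorandom. **Functionality $\mathcal{F}_{\mathsf{ssPEQT}}$** (secret-shared private equality test). On input $x\in\{0,1\}^\gamma$ from one party and $y\in\{0,1\}^\gamma$ from the other, sample random bits $a,b$ subject to $a\oplus b=1$ if $x=y$ and $a\oplus b=0$ otherwise. Give $a$ to the first party and $b$ to the second. **Protocol $\Pi_{\mathsf{bssPMT}}$.** Inputs are as in $\mathcal{F}_{\mathsf{bssPMT}}$. 1. For each $i\in[B]$, $\mathcal{S}$ chooses a uniform $s_i\gets\{0,1\}^\gamma$ and lets $S_i$ be the multiset consisting of $|X_i|$ copies of $s_i$. 2. The parties invoke $\mathcal{F}_{\mathsf{bOPPRF}}$ with batch size $B$. $\mathcal{S}$ inputs key sets $X_1,\dots,X_B$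 and value sets $S_1,\dots,S_B$; $\mathcal{R}$ inputs $\vec x$ and receives $\vec t=(t_1,\dots,t_B)$. 3. The parties invoke $B$ instances of $\mathcal{F}_{\mathsf{ssPEQT}}$. In the $i$-th, $\mathcal{S}$ inputs $s_i$ and $\mathcal{R}$ inputs $t_i$; $\mathcal{S}$ receives $e_S^i$ and $\mathcal{R}$ receives $e_R^i$. The parties output the vectors of these bits. **Security notion.** Adversaries are static and semi-honest: corrupted parties follow the protocol. A party's view consists of its input, its random tape and all messages it receives, including outputs of ideal functionalities. A protocol securely realizes $\mathcal{F}$ in a hybrid model (parties have access to the listed ideal functionalities) if the following hold. (Correctness) For all inputs, the joint outputs of all parties are computationally indistinguishable from the outputs of $\mathcal{F}$, up to an error negligible in the security parameters. (Privacy) For every admissible set of corrupted parties (here, either single party) there is a PPT simulator that, given the inputs of the corrupted parties and their outputs from $\mathcal{F}$, generates simulated views such that, for all inputs, the joint distribution of the corrupted parties' outputs and simulated views is computationally indistinguishable from the joint distribution of their outputs and views in the real execution. *)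

(* Defs.v *)
From HB Require Import structures.
From mathcomp Require Import all_boot all_order all_algebra.
From mathcomp Require Import reals exp.

Set Implicit Arguments.
Unset Strict Implicit.
Unset Printing Implicit Defensive.

Import Order.TTheory GRing.Theory Num.Theory.
Local Open Scope ring_scope.

(* Outcomes may be repeated in the list; the weight of an event is the sum over
   all entries.  No equality on T is needed, so T may be a function type. *)
Record dist (R : realType) (T : Type) := Dist {
  outcomes : seq (R * T);
  weight_ge0 : all (fun p => 0 <= p.1) outcomes;
  weight_sum1 : \sum_(p <- outcomes) p.1 = 1
}.

Definition pr (R : realType) T (mu : dist R T) (E : T -> bool) : R :=
  \sum_(p <- outcomes mu | E p.2) p.1.

Lemma dret_subproof (R : realType) T (x : T) :
  all (fun p : R * T => 0 <= p.1) [:: (1, x)] /\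
  \sum_(p <- [:: (1, x) : R * T]) p.1 = 1.
Proof. by rewrite /= ler01 big_seq1. Qed.

Definition dret (R : realType) T (x : T) : dist R T :=
  Dist (dret_subproof R x).1 (dret_subproof R x).2.

Definition bind_outcomes (R : realType) T U (mu : dist R T)
    (f : T -> dist R U) : seq (R * U) :=
  [seq (p.1 * q.1, q.2) | p <- outcomes mu, q <- outcomes (f p.2)].

Lemma dbind_subproof (R : realType) T U (mu : dist R T) (f : T -> dist R U) :
  all (fun p => 0 <= p.1) (bind_outcomes mu f) /\
  \sum_(p <- bind_outcomes mu f) p.1 = 1.
Proof.
split; last first.
  rewrite /bind_outcomes big_allpairs_dep /= -[RHS](weight_sum1 mu).
  apply: eq_bigr => p _ /=.
  by rewrite -big_distrr /= weight_sum1 mulr1.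
rewrite /bind_outcomes; elim: (outcomes mu) (weight_ge0 mu) => //= p s IHs.
case/andP=> p0 /IHs s0; rewrite all_cat s0 andbT all_map.
apply: sub_all (weight_ge0 (f p.2)) => q q0 /=.
exact: mulr_ge0.
Qed.

Definition dbind (R : realType) T U (mu : dist R T) (f : T -> dist R U) :
    dist R U :=
  Dist (dbind_subproof mu f).1 (dbind_subproof mu f).2.

Notation "x <-$ mu ; e" := (dbind mu (fun x => e))
  (at level 100, mu at next level, e at level 200, right associativity).

(* x0 only witnesses that T is inhabited. *)
Lemma dunif_subproof (R : realType) (T : finType) (x0 : T) :
  all (fun p : R * T => 0 <= p.1) [seq (#|T|%:R^-1, x) | x <- enum T] /\
  \sum_(p <- [seq (#|T|%:R^-1 : R, x) | x <- enum T]) p.1 = 1.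
Proof.
split; first by rewrite all_map; apply/allP => x _ /=; rewrite invr_ge0 ler0n.
rewrite big_map /= big_enum sumr_const -[LHS]mulr_natr mulVf //.
by rewrite pnatr_eq0 -lt0n; apply/card_gt0P; exists x0.
Qed.

Definition dunif (R : realType) (T : finType) (x0 : T) : dist R T :=
  Dist (dunif_subproof R x0).1 (dunif_subproof R x0).2.

Notation bits n := (n.-tuple bool).

Definition dflip (R : realType) : dist R bool := dunif R false.

Definition dbits (R : realType) (n : nat) : dist R (bits n) :=
  dunif R [tuple of nseq n false].

Fixpoint dprod (R : realType) T (n : nat) :
    ('I_n -> dist R T) -> dist R (n.-tuple T) :=
  if n is n'.+1 then fun f =>
    a <-$ f ord0; t <-$ dprod (fun i => f (lift ord0 i)); dret R [tuple of a :: t]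
  else fun=> dret R [tuple].

(* Machines are probabilistic programs of the WHILE language of N. Jones
   (Computability and Complexity, MIT Press, 1997): the data are binary trees
   and every command costs one time unit.  With trees represented by pointers,
   the class of problems solvable in polynomial time is that of Turing
   machines. *)
Inductive tree := TNil | TCons of tree & tree.

Fixpoint tree_size (v : tree) : nat :=
  (if v is TCons a b then (tree_size a + tree_size b).+1 else 1)%N.

Inductive expr :=
  | EVar of nat
  | ENil
  | ECons of expr & expr
  | EHd of expr
  | ETl of expr.

Inductive cmd :=
  | Assign of nat & expr
  | Toss of nat
  | Seq of cmd & cmd
  | If of expr & cmd & cmd
  | While of expr & cmd.

Definition store := nat -> tree.

Definition upd (s : store) (x : nat) (v : tree) : store :=
  fun y => if y == x then v else s y.

Fixpoint eval (s : store) (e : expr) : tree :=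
  match e with
  | EVar x => s x
  | ENil => TNil
  | ECons a b => TCons (eval s a) (eval s b)
  | EHd a => if eval s a is TCons v _ then v else TNil
  | ETl a => if eval s a is TCons _ v then v else TNil
  end.

(* TNil is false, every other tree is true. *)
Definition truth (v : tree) : bool := if v is TNil then false else true.

Definition tree_of_bool (b : bool) : tree := if b then TCons TNil TNil else TNil.

(* The commands still to be executed, and the store. *)
Definition config := (seq cmd * store)%type.

Definition step (R : realType) (c : config) : dist R config :=
  let: (k, s) := c in
  match k with
  | [::] => dret R ([::], s)
  | Assign x e :: k' => dret R (k', upd s x (eval s e))
  | Toss x :: k' => b <-$ dflip R; dret R (k', upd s x (tree_of_bool b))
  | Seq a b :: k' => dret R (a :: b :: k', s)
  | If e a b :: k' => dret R ((if truth (eval s e) then a else b) :: k', s)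
  | While e a :: k' =>
      dret R (if truth (eval s e) then a :: While e a :: k' else k', s)
  end.

Fixpoint steps (R : realType) (n : nat) (c : config) : dist R config :=
  if n is n'.+1 then c' <-$ step R c; steps R n' c' else dret R c.

Definition halted (c : config) : bool := nilp c.1.

(* Variable 0 holds the input at the start and the output at the end. *)
Definition init (p : cmd) (v : tree) : config :=
  ([:: p], upd (fun=> TNil) 0 v).

Record ppt (R : realType) := Ppt {
  code : cmd;
  deg : nat;
  ppt_halts : forall v : tree,
    pr (steps R (tree_size v ^ deg + deg) (init code v)) halted = 1
}.

Definition apply (R : realType) (A : ppt R) (v : tree) : dist R tree :=
  c <-$ steps R (tree_size v ^ deg A + deg A) (init (code A) v); dret R (c.2 0%N).

Class encodable (T : Type) := enc : T -> tree.

#[export] Instance enc_unit : encodable unit := fun=> TNil.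

#[export] Instance enc_bool : encodable bool := tree_of_bool.

Fixpoint unary (n : nat) : tree := if n is n'.+1 then TCons TNil (unary n') else TNil.

#[export] Instance enc_nat : encodable nat := unary.

#[export] Instance enc_prod T U (eT : encodable T) (eU : encodable U) :
    encodable (T * U) :=
  fun p => TCons (enc p.1) (enc p.2).

#[export] Instance enc_seq T (eT : encodable T) : encodable (seq T) :=
  fun s => foldr (fun x v => TCons (enc x) v) TNil s.

#[export] Instance enc_tuple T n (eT : encodable T) : encodable (n.-tuple T) :=
  fun t => enc (tval t).

#[export] Instance enc_set (T : finType) (eT : encodable T) : encodable {set T} :=
  fun A => enc (enum A).

(* Ensembles are indexed by the computational security parameter lambda and the
   statistical security parameter sigma, in this order. *)

Definition poly_bounded (f : nat -> nat -> nat) : Prop :=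
  exists c : nat, forall lambda sigma,
    (f lambda sigma <= (lambda + sigma) ^ c + c)%N.

Definition negligible (R : realType) (f : nat -> R) : Prop :=
  forall c : nat, exists N : nat, forall n : nat, (N < n)%N ->
    `|f n| <= (n%:R ^+ c)^-1.

Definition advantage (R : realType) (D : ppt R) (a : tree)
    (mu nu : dist R tree) : R :=
  `| pr (v <-$ mu; apply D (TCons a v)) truth
     - pr (v <-$ nu; apply D (TCons a v)) truth |.

(* Distinguishers are non-uniform: they receive an advice string of polynomial
   size, which also serves as padding when a sample is short.  The advice may
   depend on the index i of the ensemble; as the bound on the advantage is
   uniform in i, this amounts to advice chosen for the worst index at
   (lambda, sigma). *)
Definition indist (R : realType) (I : nat -> nat -> Type)
    (valid : forall lambda sigma, I lambda sigma -> Prop)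
    (mu nu : forall lambda sigma, I lambda sigma -> dist R tree) : Prop :=
  forall (D : ppt R) (a : forall lambda sigma, I lambda sigma -> tree)
    (p : nat -> nat -> nat),
    poly_bounded p ->
    (forall lambda sigma i, valid lambda sigma i ->
       (tree_size (a lambda sigma i) <= p lambda sigma)%N) ->
    exists f g : nat -> R, negligible f /\ negligible g /\
      forall lambda sigma i, valid lambda sigma i ->
        advantage D (a lambda sigma i) (mu lambda sigma i) (nu lambda sigma i)
          <= f lambda + g sigma.

Record execution (OS OR VS VR : Type) := Execution {
  out_S : OS;
  out_R : OR;
  view_S : VS;
  view_R : VR
}.

(* IS, OS, VS (resp. IR, OR, VR) are the types of inputs, outputs and views of
   the sender (resp. receiver).  [public] holds the public parameters in unary;
   the simulators are uniform and need it to know the sizes. *)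
Definition securely_realizes (R : realType)
    (IS IR OS OR VS VR : nat -> nat -> Type)
    {eIS : forall lambda sigma, encodable (IS lambda sigma)}
    {eIR : forall lambda sigma, encodable (IR lambda sigma)}
    {eOS : forall lambda sigma, encodable (OS lambda sigma)}
    {eOR : forall lambda sigma, encodable (OR lambda sigma)}
    {eVS : forall lambda sigma, encodable (VS lambda sigma)}
    {eVR : forall lambda sigma, encodable (VR lambda sigma)}
    (public : nat -> nat -> tree)
    (valid : forall lambda sigma, IS lambda sigma * IR lambda sigma -> Prop)
    (protocol : forall lambda sigma, IS lambda sigma -> IR lambda sigma ->
       dist R (execution (OS lambda sigma) (OR lambda sigma)
                         (VS lambda sigma) (VR lambda sigma)))
    (functionality : forall lambda sigma, IS lambda sigma -> IR lambda sigma ->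
       dist R (OS lambda sigma * OR lambda sigma)) : Prop :=
  let correctness :=
    indist valid
      (fun lambda sigma i => e <-$ protocol lambda sigma i.1 i.2;
         dret R (enc (out_S e, out_R e)))
      (fun lambda sigma i => o <-$ functionality lambda sigma i.1 i.2;
         dret R (enc o)) in
  let privacy_S :=
    exists Sim : ppt R, indist valid
      (fun lambda sigma i => e <-$ protocol lambda sigma i.1 i.2;
         dret R (TCons (enc (out_S e)) (enc (view_S e))))
      (fun lambda sigma i => o <-$ functionality lambda sigma i.1 i.2;
         v <-$ apply Sim (TCons (public lambda sigma) (enc (i.1, o.1)));
         dret R (TCons (enc o.1) v)) in
  let privacy_R :=
    exists Sim : ppt R, indist valid
      (fun lambda sigma i => e <-$ protocol lambda sigma i.1 i.2;
         dret R (TCons (enc (out_R e)) (enc (view_R e))))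
      (fun lambda sigma i => o <-$ functionality lambda sigma i.1 i.2;
         v <-$ apply Sim (TCons (public lambda sigma) (enc (i.2, o.2)));
         dret R (TCons (enc o.2) v)) in
  correctness /\ privacy_S /\ privacy_R.

Definition disjoint_sets (n l : nat) (X : n.-tuple {set bits l}) : Prop :=
  forall i j : 'I_n, i != j -> [disjoint tnth X i & tnth X j].

Definition small_sets (m n l : nat) (X : n.-tuple {set bits l}) : Prop :=
  forall i : 'I_n, (#|tnth X i| <= m)%N.

Definition matching_sizes (n l gamma : nat) (K : n.-tuple {set bits l})
    (V : n.-tuple (seq (bits gamma))) : Prop :=
  forall i : 'I_n, size (tnth V i) = #|tnth K i|.

(* Given the keys k, the key sets K and the value lists V, such a family samples
   a function F : {0,1}^* x {0,1}^l -> {0,1}^gamma. *)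
Definition pprf_family (R : realType) (B l gamma kappa : nat -> nat -> nat) :=
  forall lambda sigma : nat,
    (B lambda sigma).-tuple (bits (kappa lambda sigma)) ->
    (B lambda sigma).-tuple {set bits (l lambda sigma)} ->
    (B lambda sigma).-tuple (seq (bits (gamma lambda sigma))) ->
    dist R (seq bool -> bits (l lambda sigma) -> bits (gamma lambda sigma)).

(* [enum_val j] is the j-th element of the set it is taken in. *)
Definition agrees (n l gamma kappa : nat) (k : n.-tuple (bits kappa))
    (K : n.-tuple {set bits l}) (V : n.-tuple (seq (bits gamma)))
    (F : seq bool -> bits l -> bits gamma) : bool :=
  [forall i : 'I_n, forall j : 'I_#|tnth K i|,
     F (tnth k i) (enum_val j) == nth [tuple of nseq gamma false] (tnth V i) j].

Definition pprf_programmed (R : realType) (m B l gamma kappa : nat -> nat -> nat)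
    (P : pprf_family R B l gamma kappa) : Prop :=
  forall lambda sigma k K V,
    disjoint_sets K -> small_sets (m lambda sigma) K -> matching_sizes K V ->
    pr (P lambda sigma k K V) (agrees k K V) = 1.

(* In a query list, (i, x) stands for the evaluation of F(k_i, x). *)
Definition pprf_query (B l gamma : nat -> nat -> nat) (lambda sigma : nat) : Type :=
  ((B lambda sigma).-tuple {set bits (l lambda sigma)} *
   (B lambda sigma).-tuple (seq (bits (gamma lambda sigma))) *
   seq ('I_(B lambda sigma) * bits (l lambda sigma)))%type.

Definition valid_query (m q B l gamma : nat -> nat -> nat) (lambda sigma : nat)
    (i : pprf_query B l gamma lambda sigma) : Prop :=
  let: (K, V, Q) := i in
  [/\ disjoint_sets K, small_sets (m lambda sigma) K, matching_sizes K V,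
      uniq Q /\ (size Q <= q lambda sigma)%N
    & all (fun p => p.2 \notin tnth K p.1) Q].

(* The bound is uniform in (K, V, Q), that is, the programming and the queries
   are chosen adversarially, the queries being outside of the programmed set. *)
Definition pprf_pseudorandom (R : realType)
    (m B l gamma kappa : nat -> nat -> nat)
    (P : pprf_family R B l gamma kappa) : Prop :=
  forall q : nat -> nat -> nat, poly_bounded q ->
    indist (@valid_query m q B l gamma)
      (fun lambda sigma i => let: (K, V, Q) := i in
         k <-$ dprod (fun=> dbits R (kappa lambda sigma));
         F <-$ P lambda sigma k K V;
         dret R (enc [seq F (tnth k p.1) p.2 | p <- Q]))
      (fun lambda sigma i => let: (K, V, Q) := i in
         u <-$ dprod (fun _ : 'I_(size Q) => dbits R (gamma lambda sigma));
         dret R (enc u)).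

Definition programmable_prf (R : realType)
    (m B l gamma kappa : nat -> nat -> nat)
    (P : pprf_family R B l gamma kappa) : Prop :=
  pprf_programmed m P /\ pprf_pseudorandom m P.

Definition dshare (R : realType) (e : bool) : dist R (bool * bool) :=
  a <-$ dflip R; dret R (a, a (+) e).

Definition F_ssPEQT (R : realType) (gamma : nat) (x y : bits gamma) :
    dist R (bool * bool) :=
  dshare R (x == y).

(* Output of the receiver; the sender has none. *)
Definition F_bOPPRF (R : realType) (B l gamma kappa : nat -> nat -> nat)
    (P : pprf_family R B l gamma kappa) (lambda sigma : nat)
    (K : (B lambda sigma).-tuple {set bits (l lambda sigma)})
    (V : (B lambda sigma).-tuple (seq (bits (gamma lambda sigma))))
    (x : (B lambda sigma).-tuple (bits (l lambda sigma))) :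
    dist R ((B lambda sigma).-tuple (bits (gamma lambda sigma))) :=
  k <-$ dprod (fun=> dbits R (kappa lambda sigma));
  F <-$ P lambda sigma k K V;
  dret R [tuple F (tnth k i) (tnth x i) | i < B lambda sigma].

Definition F_bssPMT (R : realType) (B l : nat -> nat -> nat) (lambda sigma : nat)
    (X : (B lambda sigma).-tuple {set bits (l lambda sigma)})
    (x : (B lambda sigma).-tuple (bits (l lambda sigma))) :
    dist R ((B lambda sigma).-tuple bool * (B lambda sigma).-tuple bool) :=
  e <-$ dprod (fun i => dshare R (tnth x i \in tnth X i));
  dret R ([tuple of map fst e], [tuple of map snd e]).

(* A view consists of the input, the random tape and the received messages. *)
Definition sender_view (B l gamma : nat -> nat -> nat) (lambda sigma : nat) : Type :=
  ((B lambda sigma).-tuple {set bits (l lambda sigma)} *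
   (B lambda sigma).-tuple (bits (gamma lambda sigma)) *
   (B lambda sigma).-tuple bool)%type.

Definition receiver_view (B l gamma : nat -> nat -> nat) (lambda sigma : nat) : Type :=
  ((B lambda sigma).-tuple (bits (l lambda sigma)) *
   unit *
   ((B lambda sigma).-tuple (bits (gamma lambda sigma)) *
    (B lambda sigma).-tuple bool))%type.

#[export] Instance enc_sender_view B l gamma lambda sigma :
    encodable (sender_view B l gamma lambda sigma) :=
  ltac:(rewrite /sender_view; exact _).

#[export] Instance enc_receiver_view B l gamma lambda sigma :
    encodable (receiver_view B l gamma lambda sigma) :=
  ltac:(rewrite /receiver_view; exact _).

(* The two functionalities are oracles of the protocol (hybrid model). *)
Definition Pi_bssPMT (R : realType) (B l gamma : nat -> nat -> nat)
    (bOPPRF : forall lambda sigma,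
       (B lambda sigma).-tuple {set bits (l lambda sigma)} ->
       (B lambda sigma).-tuple (seq (bits (gamma lambda sigma))) ->
       (B lambda sigma).-tuple (bits (l lambda sigma)) ->
       dist R ((B lambda sigma).-tuple (bits (gamma lambda sigma))))
    (ssPEQT : forall gamma : nat, bits gamma -> bits gamma ->
       dist R (bool * bool))
    (lambda sigma : nat)
    (X : (B lambda sigma).-tuple {set bits (l lambda sigma)})
    (x : (B lambda sigma).-tuple (bits (l lambda sigma))) :
    dist R (execution ((B lambda sigma).-tuple bool) ((B lambda sigma).-tuple bool)
              (sender_view B l gamma lambda sigma)
              (receiver_view B l gamma lambda sigma)) :=
  s <-$ dprod (fun=> dbits R (gamma lambda sigma));
  t <-$ bOPPRF lambda sigma X
          [tuple nseq #|tnth X i| (tnth s i) | i < B lambda sigma] x;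
  e <-$ dprod (fun i => ssPEQT (gamma lambda sigma) (tnth s i) (tnth t i));
  let e_S := [tuple of map fst e] in
  let e_R := [tuple of map snd e] in
  dret R (Execution e_S e_R (X, s, e_S) (x, tt, (t, e_R))).

Definition bssPMT_public (B l gamma : nat -> nat -> nat) (lambda sigma : nat) : tree :=
  enc [:: lambda; sigma; B lambda sigma; l lambda sigma; gamma lambda sigma].

Definition bssPMT_valid (m B l : nat -> nat -> nat) (lambda sigma : nat)
    (i : (B lambda sigma).-tuple {set bits (l lambda sigma)} *
         (B lambda sigma).-tuple (bits (l lambda sigma))) : Prop :=
  disjoint_sets i.1 /\ small_sets (m lambda sigma) i.1.

(* Main.v *)
Require Import Defs.
From HB Require Import structures.
From mathcomp Require Import all_boot all_order all_algebra.
From mathcomp Require Import reals exp.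
From mathcomp Require Import boolp zify lra.

(* In the sender's view everything is distributed as in the ideal execution, since
   its shares are uniform and independent of the secrets.  For the receiver, the
   OPPRF outputs at members are uniform secrets and the others are pseudorandom;
   for every fixed choice of secrets and shares, a program that merges known
   secrets with queried values and then runs the distinguisher reduces the
   privacy to the pseudorandomness of the PPRF.  Correctness fails only if some
   unprogrammed output collides with its secret.  A program testing for a
   collision (a walk through one-path tries given as advice) shows that this is
   no likelier, up to the PPRF advantage, than for uniform values, hence bounded
   by B / 2^gamma <= 2^-sigma. *)

Set Implicit Arguments.
Unset Strict Implicit.
Unset Printing Implicit Defensive.

Import Order.TTheory GRing.Theory Num.Theory.
Local Open Scope ring_scope.

(** * Expectations of finite distributions *)

(** Equality in law is expressed throughout as equality of expectations of test functions, since
    outcome lists carry an irrelevant order and repetitions. *)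
Definition ex (R : realType) T (mu : dist R T) (g : T -> R) : R :=
  \sum_(p <- outcomes mu) p.1 * g p.2.

Section Expectation.
Variable R : realType.

Lemma exE T (mu : dist R T) (g : T -> R) :
  ex mu g = \sum_(i < size (outcomes mu))
    (tnth (in_tuple (outcomes mu)) i).1 * g (tnth (in_tuple (outcomes mu)) i).2.
Proof. by rewrite /ex big_tnth. Qed.

Lemma weight_tnth_ge0 T (mu : dist R T) i :
  0 <= (tnth (in_tuple (outcomes mu)) i).1.
Proof. exact: (elimT (@all_tnthP _ _ _ (in_tuple _)) (weight_ge0 mu) i). Qed.

Lemma prE T (mu : dist R T) (E : T -> bool) : pr mu E = ex mu (fun x => (E x)%:R).
Proof.
rewrite /pr /ex big_mkcond /=; apply: eq_bigr => p _.
by case: (E _); rewrite ?mulr1 ?mulr0.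
Qed.

Lemma ex_ret T (x : T) (g : T -> R) : ex (dret R x) g = g x.
Proof. by rewrite /ex /= big_seq1 mul1r. Qed.

Lemma ex_bind T U (mu : dist R T) (f : T -> dist R U) (g : U -> R) :
  ex (dbind mu f) g = ex mu (fun x => ex (f x) g).
Proof.
rewrite /ex /= /bind_outcomes big_allpairs_dep /=; apply: eq_bigr => p _.
by rewrite big_distrr /=; apply: eq_bigr => q _; rewrite mulrA.
Qed.

Lemma eq_ex T (mu : dist R T) (g h : T -> R) : g =1 h -> ex mu g = ex mu h.
Proof. by move=> gh; apply: eq_bigr => p _; rewrite gh. Qed.

Lemma ex_cst T (mu : dist R T) (c : R) : ex mu (fun=> c) = c.
Proof. by rewrite /ex -mulr_suml weight_sum1 mul1r. Qed.

Lemma exD T (mu : dist R T) (g h : T -> R) :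
  ex mu (fun x => g x + h x) = ex mu g + ex mu h.
Proof. by rewrite /ex -big_split; apply: eq_bigr => p _; rewrite mulrDr. Qed.

Lemma exB T (mu : dist R T) (g h : T -> R) :
  ex mu (fun x => g x - h x) = ex mu g - ex mu h.
Proof.
by rewrite /ex -sumrB; apply: eq_bigr => p _; rewrite mulrBr.
Qed.

Lemma ex_swap T U (mu : dist R T) (nu : dist R U) (g : T -> U -> R) :
  ex mu (fun x => ex nu (g x)) = ex nu (fun y => ex mu (g^~ y)).
Proof.
rewrite /ex; under eq_bigr do rewrite big_distrr /=.
rewrite exchange_big /=; apply: eq_bigr => q _; rewrite big_distrr /=.
by apply: eq_bigr => p _; rewrite mulrCA.
Qed.

Lemma ler_ex T (mu : dist R T) (g h : T -> R) :
  (forall x, g x <= h x) -> ex mu g <= ex mu h.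
Proof.
move=> gh; rewrite !exE; apply: ler_sum => i _.
by rewrite ler_wpM2l ?weight_tnth_ge0.
Qed.

Lemma ex_itv01 T (mu : dist R T) (g : T -> R) :
  (forall x, 0 <= g x <= 1) -> 0 <= ex mu g <= 1.
Proof.
move=> g01; rewrite -[X in X <= _](ex_cst mu) -[X in _ && (_ <= X)](ex_cst mu).
by rewrite !ler_ex // => x; case/andP: (g01 x).
Qed.

Lemma ler_norm_ex T (mu : dist R T) (g : T -> R) :
  `|ex mu g| <= ex mu (fun x => `|g x|).
Proof.
rewrite !exE; apply: (le_trans (ler_norm_sum _ _ _)); apply: ler_sum => i _.
by rewrite normrM (ger0_norm (weight_tnth_ge0 _)).
Qed.

(** Weights are nonnegative and the complement of [E] has total weight zero, so every entry outside
    of [E] has weight zero. This serves for halting and for programmed values, both of probability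
    one. *)
Lemma eq_ex_pr1 T (mu : dist R T) (E : T -> bool) (g h : T -> R) :
  pr mu E = 1 -> (forall x, E x -> g x = h x) -> ex mu g = ex mu h.
Proof.
move=> E1 gh.
have E0 : ex mu (fun x => (~~ E x)%:R) = 0.
  apply: (addrI (ex mu (fun x => (E x)%:R))).
  rewrite -exD addr0 -prE E1 -[RHS](ex_cst mu); apply: eq_ex => x.
  by case: (E x); rewrite ?addr0 ?add0r.
rewrite !exE; apply: eq_bigr => i _; set p := tnth _ i.
have [Ep|nEp] := boolP (E p.2); first by rewrite gh.
suff -> : p.1 = 0 by rewrite !mul0r.
move: E0; rewrite exE => /eqP; rewrite psumr_eq0; last first.
  by move=> j _; rewrite mulr_ge0 ?weight_tnth_ge0 ?ler0n.
by move/allP => /(_ i (mem_index_enum _)); rewrite -/p nEp mulr1 => /eqP.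
Qed.

Lemma ex_unif (T : finType) (x0 : T) (g : T -> R) :
  ex (dunif R x0) g = #|T|%:R^-1 * \sum_x g x.
Proof. by rewrite /ex big_map big_enum /= big_distrr. Qed.

(* Independent identically distributed lists; unlike [dprod], the length is not
   part of the type. *)
Fixpoint dseq T (mu : dist R T) (n : nat) : dist R (seq T) :=
  if n is n'.+1 then a <-$ mu; t <-$ dseq mu n'; dret R (a :: t) else dret R [::].

Lemma ex_dseqS T (mu : dist R T) n (g : seq T -> R) :
  ex (dseq mu n.+1) g = ex mu (fun a => ex (dseq mu n) (fun t => g (a :: t))).
Proof.
rewrite ex_bind; apply: eq_ex => a; rewrite ex_bind; apply: eq_ex => t.
exact: ex_ret.
Qed.

(** Needed because the sampling loops push onto an accumulator, where the first draw ends up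
    last. *)
Lemma ex_dseqSr T (mu : dist R T) n (g : seq T -> R) :
  ex (dseq mu n.+1) g = ex mu (fun a => ex (dseq mu n) (fun t => g (rcons t a))).
Proof.
elim: n g => [|n IHn] g.
  by rewrite ex_dseqS; apply: eq_ex => a; rewrite !ex_ret.
rewrite ex_dseqS; under eq_ex do rewrite IHn.
rewrite ex_swap; apply: eq_ex => a.
by rewrite ex_dseqS.
Qed.

Lemma ex_dseq_rev T (mu : dist R T) n (g : seq T -> R) :
  ex (dseq mu n) (g \o rev) = ex (dseq mu n) g.
Proof.
elim: n g => [|n IHn] g; first by rewrite !ex_ret.
rewrite ex_dseqS ex_dseqSr; apply: eq_ex => a.
rewrite -[RHS]IHn; by apply: eq_ex => t /=; rewrite rev_cons.
Qed.

Lemma ex_dprod0 T (f : 'I_0 -> dist R T) (g : 0.-tuple T -> R) :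
  ex (dprod f) g = g [tuple].
Proof. by rewrite ex_ret. Qed.

Lemma ex_dprodS T n (f : 'I_n.+1 -> dist R T) (g : n.+1.-tuple T -> R) :
  ex (dprod f) g =
  ex (f ord0) (fun a => ex (dprod (fun i => f (lift ord0 i)))
                          (fun t => g [tuple of a :: t])).
Proof.
rewrite ex_bind; apply: eq_ex => a; rewrite ex_bind; apply: eq_ex => t.
exact: ex_ret.
Qed.

Lemma ex_dprod_dseq T (mu : dist R T) n (g : seq T -> R) :
  ex (dprod (fun _ : 'I_n => mu)) (fun t => g t) = ex (dseq mu n) g.
Proof.
elim: n g => [|n IHn] g; first by rewrite ex_dprod0 ex_ret.
rewrite ex_dprodS ex_dseqS; apply: eq_ex => a.
exact: (IHn (fun t => g (a :: t))).
Qed.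

(** Splitting off the first bit is a bijection from tuples to pairs, so the uniform law factors into
    independent flips. *)
Lemma ex_dbits n (g : seq bool -> R) :
  ex (dbits R n) (fun t => g t) = ex (dseq (dflip R) n) g.
Proof.
elim: n g => [|n IHn] g.
  rewrite ex_ret ex_unif card_tuple expn0 invr1 mul1r.
  rewrite (big_pred1 [tuple]) // => t.
  by apply/esym/eqP; exact: tuple0.
rewrite ex_dseqS.
rewrite -(eq_ex _ (fun a => IHn (fun t => g (a :: t)))) ex_swap.
rewrite /dbits /dflip !ex_unif.
under [in RHS]eq_bigr do rewrite ex_unif.
rewrite !card_tuple card_bool expnS natrM invfM -mulrA mulrCA; congr (_ * _).
rewrite -big_distrr /=; congr (_ * _).
rewrite pair_big /=.
rewrite (reindex (fun p : n.-tuple bool * bool => [tuple of p.2 :: p.1])) //=.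
exists (fun t : n.+1.-tuple bool => ([tuple of behead t], thead t)) => [[t b] _|t _].
  by congr (_, _); apply: val_inj.
by rewrite [RHS]tuple_eta; apply: val_inj.
Qed.

End Expectation.

(** * Polynomial bounds *)

(** The base [sz a + 2] is at least 2, so powers grow with the exponent and absorb constants; this
    makes the class closed under sums, products and powers. *)
Definition pbd A (sz f : A -> nat) : Prop :=
  exists c, forall a, (f a <= (sz a + 2) ^ c)%N.

Section PolynomialBounds.
Variables (A : Type) (sz : A -> nat).
Implicit Types f g : A -> nat.

Lemma pbd_le f g : pbd sz g -> (forall a, (f a <= g a)%N) -> pbd sz f.
Proof. by case=> c gc fg; exists c => a; apply: leq_trans (gc a). Qed.

Lemma pbd_sz : pbd sz sz.
Proof. by exists 1%N => a; rewrite expn1 leq_addr. Qed.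

Lemma pbd_cst k : pbd sz (fun=> k).
Proof.
exists k => a; apply: leq_trans (ltnW (ltn_expl k (isT : 1 < 2)%N)) _.
by case: k => // k; rewrite leq_exp2r // leq_addl.
Qed.

Lemma pbdM f g : pbd sz f -> pbd sz g -> pbd sz (fun a => f a * g a)%N.
Proof.
by case=> c fc [d gd]; exists (c + d)%N => a; rewrite expnD leq_mul.
Qed.

Lemma pbdD f g : pbd sz f -> pbd sz g -> pbd sz (fun a => f a + g a)%N.
Proof.
case=> c fc [d gd]; exists (maxn c d).+1 => a.
rewrite expnS; apply: (@leq_trans (2 * (sz a + 2) ^ maxn c d)).
  rewrite mul2n -addnn leq_add //.
    by rewrite (leq_trans (fc a)) // leq_pexp2l ?addn2 // leq_maxl.
  by rewrite (leq_trans (gd a)) // leq_pexp2l ?addn2 // leq_maxr.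
by rewrite leq_mul2r leq_addl orbT.
Qed.

Lemma pbdX f d : pbd sz f -> pbd sz (fun a => f a ^ d)%N.
Proof.
case=> c fc; exists (c * d)%N => a; rewrite expnM.
by case: d => // d; rewrite leq_exp2r.
Qed.

Lemma pbd_deg f : pbd sz f -> exists d, forall a, (f a <= sz a ^ d + d)%N.
Proof.
(* If [sz a <= 1], the bound is at most [3 ^ c]; otherwise [sz a + 2 <= sz a ^ 2], which doubles the
   exponent. *)
case=> c fc; exists (c.*2 + 3 ^ c)%N => a; apply: leq_trans (fc a) _.
case: (leqP (sz a) 1) => sz1.
  apply: (@leq_trans (3 ^ c)); last by rewrite addnA leq_addl.
  by case: (c) => // c'; rewrite leq_exp2r // addn2 !ltnS.
apply: leq_trans (leq_addr _ _).
apply: (@leq_trans ((sz a ^ 2) ^ c)).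
  by case: (c) => // c'; rewrite leq_exp2r //; nia.
by rewrite -expnM mul2n leq_pexp2l ?leq_addr // ltnW.
Qed.

End PolynomialBounds.

Definition secparam (k : nat * nat) : nat := (k.1 + k.2)%N.

Lemma poly_bounded_pbd f : poly_bounded f -> pbd secparam (fun k => f k.1 k.2).
Proof.
case=> c fc; apply: (@pbd_le _ _ _ (fun k => secparam k ^ c + c)%N).
  by apply: pbdD; [apply/pbdX/pbd_sz | apply: pbd_cst].
by move=> k; apply: fc.
Qed.

Lemma pbd_poly_bounded f : pbd secparam (fun k => f k.1 k.2) -> poly_bounded f.
Proof. by case/pbd_deg=> d fd; exists d => l s; apply: (fd (l, s)). Qed.

(** * Running WHILE programs *)

Section Machines.
Variable R : realType.
Implicit Types (k : seq cmd) (s : store) (K : (tree -> R) -> R).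

Lemma ex_stepsS n c (g : config -> R) :
  ex (steps R n.+1 c) g = ex (step R c) (fun c' => ex (steps R n c') g).
Proof. exact: ex_bind. Qed.

(* From [c], the machine halts within [N] steps, and [K] is the expectation under
   the law of its output.  The choice of [K] being independent of the exact
   running time makes this relation compositional backwards. *)
Definition wp N c K : Prop :=
  forall m, (N <= m)%N -> forall (g : config -> R) (h : tree -> R),
    (forall s, g ([::], s) = h (s 0%N)) -> ex (steps R m c) g = K h.

Lemma wpW N N' c K : (N <= N')%N -> wp N c K -> wp N' c K.
Proof. by move=> NN' H m /(leq_trans NN'); apply: H. Qed.

Lemma eq_wp N c K K' : wp N c K -> K =1 K' -> wp N c K'.
Proof. by move=> H KK' m Nm g h gh; rewrite -KK'; apply: H. Qed.

Lemma ex_steps_nil m s (g : config -> R) : ex (steps R m ([::], s)) g = g ([::], s).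
Proof.
elim: m => [|m IHm]; first exact: ex_ret.
by rewrite ex_stepsS ex_ret.
Qed.

Lemma wp_halt s : wp 0 ([::], s) (fun h => h (s 0%N)).
Proof. by move=> m _ g h gh; rewrite ex_steps_nil. Qed.

Lemma wp_step N c c' K : step R c = dret R c' -> wp N c' K -> wp N.+1 c K.
Proof.
move=> Hc H [//|m] Nm g h gh; by rewrite ex_stepsS Hc ex_ret (H _ _ _ h).
Qed.

Lemma wp_assign N k s x e K :
  wp N (k, upd s x (eval s e)) K -> wp N.+1 (Assign x e :: k, s) K.
Proof. exact: wp_step. Qed.

Lemma wp_seq N k s a b K : wp N (a :: b :: k, s) K -> wp N.+1 (Seq a b :: k, s) K.
Proof. exact: wp_step. Qed.

Lemma wp_if N k s e a b K :
  wp N ((if truth (eval s e) then a else b) :: k, s) K ->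
  wp N.+1 (If e a b :: k, s) K.
Proof. exact: wp_step. Qed.

Lemma wp_while N k s e a K :
  wp N (if truth (eval s e) then a :: While e a :: k else k, s) K ->
  wp N.+1 (While e a :: k, s) K.
Proof. exact: wp_step. Qed.

Lemma wp_toss N k s x (K : bool -> (tree -> R) -> R) :
  (forall b, wp N (k, upd s x (tree_of_bool b)) (K b)) ->
  wp N.+1 (Toss x :: k, s) (fun h => ex (dflip R) (K^~ h)).
Proof.
move=> H [//|m] Nm g h gh; rewrite ex_stepsS ex_bind; apply: eq_ex => b.
by rewrite ex_ret (H b _ _ _ h).
Qed.

Lemma ex_stepsD n m c (g : config -> R) :
  ex (steps R (n + m) c) g = ex (steps R n c) (fun c' => ex (steps R m c') g).
Proof.
elim: n c => [|n IHn] c; first by rewrite ex_ret.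
by rewrite addSn !ex_stepsS; apply: eq_ex => c'.
Qed.

Lemma ex_apply (D : ppt R) v (h : tree -> R) :
  ex (apply D v) h =
  ex (steps R (tree_size v ^ deg D + deg D) (init (code D) v))
     (fun c => h (c.2 0%N)).
Proof. by rewrite ex_bind; apply: eq_ex => c; rewrite ex_ret. Qed.

(** A halted configuration no longer changes, so running beyond the declared bound preserves the law
    of the output; outcomes that have not halted weigh nothing. *)
Lemma wp_ppt (D : ppt R) v :
  wp (tree_size v ^ deg D + deg D) (init (code D) v) (ex (apply D v)).
Proof.
move=> m Nm g h gh; rewrite ex_apply -(subnKC Nm) ex_stepsD.
apply: (eq_ex_pr1 (ppt_halts D v)) => -[[|//] s] _.
by rewrite ex_steps_nil gh.
Qed.

Definition st (l : seq tree) : store := nth TNil l.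

Lemma upd_st l x v : upd (st l) x v = st (set_nth TNil l x v).
Proof. by apply/funext => y; rewrite /upd /st nth_set_nth. Qed.

(** The length [n] is free, so that each program can list exactly the variables it uses and be
    executed symbolically on a finite list. *)
Lemma init_st p v n : init p v = ([:: p], st (v :: nseq n TNil)).
Proof.
congr (_, _); apply/funext => -[|y] //; rewrite /st /upd /= nth_nseq.
by case: ifP.
Qed.

Lemma ppt_of_wp (p : cmd) (T : tree -> nat) (K : tree -> (tree -> R) -> R) :
  pbd tree_size T ->
  (forall v, wp (T v) (init p v) (K v)) ->
  (forall v, K v (fun=> 1) = 1) ->
  exists A : ppt R, forall v g, ex (apply A v) g = K v g.
Proof.
case/pbd_deg=> d Td H K1.
(* The indicator of [halted] is 1 on final configurations, so its expectation is [K v] at the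
   constant 1. *)
have h v : pr (steps R (tree_size v ^ d + d) (init p v)) halted = 1.
  by rewrite prE (H v _ (Td v) _ (fun=> 1)).
by exists (Ppt h) => v g; rewrite ex_apply /= (H v _ (Td v) _ g).
Qed.

End Machines.

(** * The programs of the reductions and of the simulators *)

Definition thd v : tree := if v is TCons a _ then a else TNil.
Definition ttl v : tree := if v is TCons _ b then b else TNil.

Fixpoint spine v : nat := if v is TCons _ b then (spine b).+1 else 0.

Lemma thd_size v : (tree_size (thd v) <= tree_size v)%N.
Proof. by case: v => //= a b; lia. Qed.

Lemma ttl_size v : (tree_size (ttl v) <= tree_size v)%N.
Proof. by case: v => //= a b; lia. Qed.

Lemma thd_ttl_size v : (tree_size (thd v) + tree_size (ttl v) <= (tree_size v).+1)%N.
Proof. by case: v => //= a b; lia. Qed.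

(* An entry [TCons _ w] of the mask [M] stands for the known value [w], an entry
   [TNil] for the next element of [U]; the result comes out reversed. *)
Fixpoint merge_tree (M U acc : tree) : tree :=
  match M with
  | TNil => acc
  | TCons TNil M' => merge_tree M' (ttl U) (TCons (thd U) acc)
  | TCons (TCons _ w) M' => merge_tree M' U (TCons w acc)
  end.

Lemma merge_tree_size M U acc :
  (tree_size (merge_tree M U acc) <= tree_size M + tree_size U + tree_size acc)%N.
Proof.
elim: M U acc => [|h _ M IHM] U acc; first by rewrite /= leq_addl.
case: h => [|h w]; apply: leq_trans (IHM _ _) _; rewrite /=; last by lia.
by have := thd_ttl_size U; lia.
Qed.

(** Variable 1 holds the mask, 2 the queried values still to be used, 3 the reversed result. *)
Definition merge_loop : cmd :=
  While (EVar 1)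
    (Seq (If (EHd (EVar 1))
            (Assign 3 (ECons (ETl (EHd (EVar 1))) (EVar 3)))
            (Seq (Assign 3 (ECons (EHd (EVar 2)) (EVar 3)))
                 (Assign 2 (ETl (EVar 2)))))
         (Assign 1 (ETl (EVar 1)))).

(** The input pairs the advice (mask, advice of the distinguisher, shares [e], inputs [x]) with the
    queried values. Variable 0 is rebuilt as what the distinguisher [p] expects: its advice, the
    receiver's output and the receiver's view. *)
Definition merge_prog (p : cmd) : cmd :=
  let e := EHd (ETl (ETl (EHd (EVar 0)))) in
  let x := ETl (ETl (ETl (EHd (EVar 0)))) in
  Seq (Assign 1 (EHd (EHd (EVar 0)))) (Seq (Assign 2 (ETl (EVar 0)))
  (Seq merge_loop
  (Seq (Assign 0 (ECons (EHd (ETl (EHd (EVar 0))))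
         (ECons e (ECons (ECons x ENil) (ECons (EVar 3) e)))))
  (Seq (Assign 2 ENil) (Seq (Assign 3 ENil) p))))).

Definition merge_out (v : tree) : tree :=
  let e := thd (ttl (ttl (thd v))) in
  TCons (thd (ttl (thd v)))
    (TCons e (TCons (TCons (ttl (ttl (ttl (thd v)))) TNil)
                    (TCons (merge_tree (thd (thd v)) (ttl v) TNil) e))).

Lemma merge_out_size v : (tree_size (merge_out v) <= 6 * tree_size v + 8)%N.
Proof.
rewrite /merge_out /=.
have := merge_tree_size (thd (thd v)) (ttl v) TNil.
have := thd_size (thd v); have := thd_size v; have := ttl_size v.
have := thd_size (ttl (thd v)); have := ttl_size (thd v).
have := thd_size (ttl (ttl (thd v))); have := ttl_size (ttl (thd v)).
have := ttl_size (ttl (ttl (thd v))); rewrite /=; lia.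
Qed.

Fixpoint walk_trie (T w : tree) : tree :=
  if w is TCons b w' then walk_trie (if truth b then thd T else ttl T) w' else T.

Fixpoint some_match (T w : tree) : bool :=
  if w is TCons w1 w' then
    truth (walk_trie (thd T) w1) || some_match (ttl T) w'
  else false.

Definition walk_loop : cmd :=
  While (EVar 3)
    (Seq (If (EHd (EVar 3)) (Assign 4 (EHd (EVar 4))) (Assign 4 (ETl (EVar 4))))
         (Assign 3 (ETl (EVar 3)))).

(** Variable 1 holds the tries, 2 the words, 3 and 4 the current word and trie, 5 the answer. The
    last [else] branch stands for a skip: variable 4 is nil there already. *)
Definition match_loop : cmd :=
  While (EVar 2)
    (Seq (Assign 3 (EHd (EVar 2))) (Seq (Assign 4 (EHd (EVar 1)))
    (Seq (Assign 2 (ETl (EVar 2))) (Seq (Assign 1 (ETl (EVar 1)))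
    (Seq walk_loop
         (If (EVar 4) (Assign 5 (ECons ENil ENil)) (Assign 4 ENil))))))).

Definition match_prog : cmd :=
  Seq (Assign 1 (EHd (EVar 0))) (Seq (Assign 2 (ETl (EVar 0)))
  (Seq match_loop (Assign 0 (EVar 5)))).

Definition toss_loop : cmd :=
  While (EVar 4) (Seq (Toss 6) (Seq (Assign 5 (ECons (EVar 6) (EVar 5)))
    (Assign 4 (ETl (EVar 4))))).

(** Variables 1 and 2 hold the number of words and their length in unary, 3 the list of words, 4 the
    inner counter, 5 the current word, 6 the tossed bit. *)
Definition sample_loop : cmd :=
  While (EVar 1) (Seq (Assign 4 (EVar 2)) (Seq (Assign 5 ENil) (Seq toss_loop
    (Seq (Assign 3 (ECons (EVar 5) (EVar 3))) (Assign 1 (ETl (EVar 1))))))).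

(** Among the public parameters, the third is the batch size and the fifth the OPPRF output
    length. *)
Definition third (v : tree) : tree := thd (ttl (ttl v)).
Definition fifth (v : tree) : tree := thd (ttl (ttl (ttl (ttl v)))).

(** Common skeleton of both simulators: the sampled strings play the sender's secrets or the
    receiver's OPPRF outputs, and [o] assembles the view. *)
Definition sample_prog (o : expr) : cmd :=
  let pub := EHd (EVar 0) in
  Seq (Assign 1 (EHd (ETl (ETl pub))))
  (Seq (Assign 2 (EHd (ETl (ETl (ETl (ETl pub))))))
  (Seq sample_loop (Assign 0 o))).

Section Programs.
Variable R : realType.
Implicit Types (k : seq cmd) (K : (tree -> R) -> R).

Lemma wp_merge_loop N k v M U acc K :
  (forall U', wp N (k, st [:: v; TNil; U'; merge_tree M U acc]) K) ->
  wp (N + 7 * tree_size M) (merge_loop :: k, st [:: v; M; U; acc]) K.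
Proof.
elim: M U acc => [|h _ M IHM] U acc H.
  by apply: (@wpW _ N.+1); [rewrite /=; lia | apply: wp_while].
(* An unknown entry costs seven commands, a known one only five. *)
apply: (@wpW _ (N + 7 * tree_size M).+1.+4.+2); first by rewrite /=; lia.
apply: wp_while; rewrite /=; apply: wp_seq; apply: wp_if; rewrite /=.
case: h H => [|h w] H /=.
  apply: wp_seq; apply: wp_assign; rewrite upd_st; apply: wp_assign.
  by rewrite upd_st; apply: wp_assign; rewrite upd_st; apply: IHM.
apply: (@wpW _ (N + 7 * tree_size M).+2) => //; first by lia.
by apply: wp_assign; rewrite upd_st; apply: wp_assign; rewrite upd_st; apply: IHM.
Qed.

Lemma merge_ppt (D : ppt R) : exists A : ppt R, forall v g,
  ex (apply A v) g = ex (apply D (merge_out v)) g.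
Proof.
pose T v := ((tree_size (merge_out v) ^ deg D + deg D) + 11 + 7 * tree_size v)%N.
have T_pbd : pbd tree_size T.
  apply: pbdD; last by apply: pbdM; [apply: pbd_cst | apply: pbd_sz].
  apply: pbdD; last exact: pbd_cst.
  apply: pbdD; last exact: pbd_cst.
  apply/pbdX/pbd_le/merge_out_size; apply: pbdD; last exact: pbd_cst.
  by apply: pbdM; [apply: pbd_cst | apply: pbd_sz].
apply: (ppt_of_wp (p := merge_prog (code D)) T_pbd) => v; last exact: ex_cst.
rewrite (init_st _ _ 3) /merge_prog.
set N := (tree_size (merge_out v) ^ deg D + deg D)%N.
apply: (@wpW _ (N.+4.+2 + 7 * tree_size (thd (thd v))).+4.+1).
  have := thd_size (thd v); have := thd_size v; rewrite /T -/N; lia.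
do 2 (apply: wp_seq; apply: wp_assign; rewrite upd_st).
apply: wp_seq; apply: wp_merge_loop => U'.
do 3 (apply: wp_seq; apply: wp_assign; rewrite upd_st).
(* Variables 1 to 3 are nil again, so [code D] starts from its own initial store. *)
by have := @wp_ppt R D (merge_out v); rewrite (init_st _ _ 3).
Qed.

Lemma wp_walk_loop N k v S w0 T w r K :
  wp N (k, st [:: v; S; w0; TNil; walk_trie T w; r]) K ->
  wp (N + 5 * tree_size w) (walk_loop :: k, st [:: v; S; w0; w; T; r]) K.
Proof.
elim: w T => [|b _ w IHw] T H.
  by apply: (@wpW _ N.+1); [rewrite /=; lia | apply: wp_while].
apply: (@wpW _ (N + 5 * tree_size w).+4.+1); first by rewrite /=; lia.
apply: wp_while; rewrite /=; apply: wp_seq; apply: wp_if; rewrite /=.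
have {}H := IHw _ H.
by case: b H => [|b b'] H; apply: wp_assign; rewrite upd_st; apply: wp_assign;
  rewrite upd_st; exact: H.
Qed.

Lemma wp_match_loop N k v S w y z r K :
  (forall S' y' z',
     wp N (k, st [:: v; S'; TNil; y'; z';
                     if some_match S w then TCons TNil TNil else r]) K) ->
  wp (N + 12 * tree_size w) (match_loop :: k, st [:: v; S; w; y; z; r]) K.
Proof.
elim: w S y z r => [|w1 _ w IHw] S y z r H.
  by apply: (@wpW _ N.+1); [rewrite /=; lia | apply: wp_while; apply: H].
apply: (@wpW _ (((N + 12 * tree_size w).+2 + 5 * tree_size w1).+4.+4.+2)).
  by rewrite /=; lia.
apply: wp_while; rewrite /=.
do 4 (apply: wp_seq; apply: wp_assign; rewrite upd_st).
apply: wp_seq; apply: (wp_walk_loop (T := thd S)); apply: wp_if; rewrite [eval _ _]/=.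
rewrite [some_match _ _]/= in H.
case: (walk_trie _ _) H => [|a b] H /=.
  by apply: wp_assign; rewrite upd_st; apply: IHw.
by apply: wp_assign; rewrite upd_st; apply: IHw => S' y' z'; rewrite if_same; apply: H.
Qed.

Lemma match_ppt : exists A : ppt R, forall v g,
  ex (apply A v) g = g (tree_of_bool (some_match (thd v) (ttl v))).
Proof.
have T_pbd : pbd tree_size (fun v => 7 + 12 * tree_size v)%N.
  by apply: pbdD; [apply: pbd_cst | apply: pbdM; [apply: pbd_cst | apply: pbd_sz]].
apply: (ppt_of_wp (p := match_prog)
    (K := fun v g => g (tree_of_bool (some_match (thd v) (ttl v)))) T_pbd) => // v.
rewrite (init_st _ _ 5) /match_prog.
apply: (@wpW _ (1 + 12 * tree_size (ttl v)).+4.+1).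
  by have := ttl_size v; lia.
do 2 (apply: wp_seq; apply: wp_assign; rewrite upd_st).
apply: wp_seq; apply: wp_match_loop => S' y' z'.
apply: wp_assign; rewrite upd_st.
by apply: eq_wp (@wp_halt R _) _.
Qed.

Lemma wp_toss_loop N k v x1 x2 x3 (c : tree) (acc : seq bool) z
    (K : seq bool -> (tree -> R) -> R) :
  (forall t z', wp N (k, st [:: v; x1; x2; x3; TNil; enc t; z']) (K t)) ->
  wp (N + 6 * tree_size c)
     (toss_loop :: k, st [:: v; x1; x2; x3; c; enc acc; z])
     (fun g => ex (dseq (dflip R) (spine c)) (fun t => K (t ++ acc) g)).
Proof.
move=> H; elim: c acc z => [|a _ c IHc] acc z.
  apply: (@wpW _ N.+1); first by rewrite /=; lia.
  apply: wp_while; apply: eq_wp (@H acc z) _ => g; by rewrite ex_ret.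
apply: (@wpW _ (N + 6 * tree_size c).+4.+2); first by rewrite /=; lia.
apply: wp_while; apply: wp_seq.
apply: eq_wp (wp_toss _) _ => [b|g] /=.
  rewrite upd_st; apply: wp_seq; apply: wp_assign; rewrite upd_st.
  apply: wp_assign; rewrite upd_st; exact: (IHc (b :: acc)).
rewrite -/(dseq _ _.+1) ex_dseqSr; apply: eq_ex => b; apply: eq_ex => t.
by rewrite cat_rcons.
Qed.

Lemma wp_sample_loop N k v (c : tree) G (acc : seq (seq bool)) w y z
    (K : seq (seq bool) -> (tree -> R) -> R) :
  (forall t w' y' z', wp N (k, st [:: v; TNil; G; enc t; w'; y'; z']) (K t)) ->
  wp (N + (9 + 6 * tree_size G) * tree_size c)
     (sample_loop :: k, st [:: v; c; G; enc acc; w; y; z])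
     (fun g => ex (dseq (dseq (dflip R) (spine G)) (spine c))
                  (fun t => K (t ++ acc) g)).
Proof.
move=> H; elim: c acc w y z => [|a _ c IHc] acc w y z.
  apply: (@wpW _ N.+1); first by rewrite /=; lia.
  apply: wp_while; apply: eq_wp (H acc w y z) _ => g; by rewrite ex_ret.
set N' := (N + (9 + 6 * tree_size G) * tree_size c)%N.
apply: (@wpW _ (N'.+3 + 6 * tree_size G).+4.+2); first by rewrite /N' /=; lia.
apply: wp_while.
do 2 (apply: wp_seq; apply: wp_assign; rewrite upd_st).
apply: wp_seq.
apply: eq_wp (wp_toss_loop [::] _ _) _ => [t z'|g].
  apply: wp_seq; apply: wp_assign; rewrite upd_st.
  apply: wp_assign; rewrite upd_st; exact: (IHc (t :: acc)).
rewrite ex_dseqSr; apply: eq_ex => t; apply: eq_ex => u.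
by rewrite cats0 cat_rcons.
Qed.

Lemma sample_ppt (o : expr) (out : tree -> tree -> tree) :
  (forall v t x1 x2 w y z,
     eval (st [:: v; x1; x2; t; w; y; z]) o = out v t) ->
  exists A : ppt R, forall v g,
    ex (apply A v) g =
    ex (dseq (dseq (dflip R) (spine (fifth (thd v)))) (spine (third (thd v))))
       (fun t => g (out v (enc t))).
Proof.
move=> oE.
have T_pbd : pbd tree_size (fun v => 6 + (9 + 6 * tree_size v) * tree_size v)%N.
  apply: pbdD; first exact: pbd_cst.
  apply: pbdM; last exact: pbd_sz.
  by apply: pbdD; [apply: pbd_cst | apply: pbdM; [apply: pbd_cst | apply: pbd_sz]].
apply: (ppt_of_wp (p := sample_prog o) (K := fun v g => ex _ (fun t => g (out v _)))
         T_pbd) => v; last exact: ex_cst.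
rewrite (init_st _ _ 6) /sample_prog.
set p := thd v.
apply: (@wpW _ (1 + (9 + 6 * tree_size (fifth p)) * tree_size (third p)).+4.+1).
  have h3 : (tree_size (third p) <= tree_size v)%N.
    by do ! (apply: leq_trans (thd_size _) _ || apply: leq_trans (ttl_size _) _).
  have h5 : (tree_size (fifth p) <= tree_size v)%N.
    by do ! (apply: leq_trans (thd_size _) _ || apply: leq_trans (ttl_size _) _).
  nia.
do 2 (apply: wp_seq; apply: wp_assign; rewrite upd_st).
apply: wp_seq.
apply: eq_wp (wp_sample_loop (K := fun t h => h (out v (enc t))) [::] _ _ _ _) _.
  move=> t w y z; apply: wp_assign; rewrite upd_st.
  by apply: eq_wp (@wp_halt R _) _ => h; rewrite -(oE v (enc t) TNil (fifth p) w y z).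
by move=> h; apply: eq_ex => t; rewrite cats0.
Qed.

End Programs.

(** * Product distributions *)

Section Products.
Variable R : realType.

(** The factors may have different laws as long as their images under [h] share one. Applied to
    shares, it shows that either party's bits alone are uniform whatever the shared bits are. *)
Lemma ex_dprod_marginal T U (h : T -> U) (nu : dist R U) n (f : 'I_n -> dist R T)
    (g : seq U -> R) :
  (forall i k, ex (f i) (fun x => k (h x)) = ex nu k) ->
  ex (dprod f) (fun e => g (map h e)) = ex (dseq nu n) g.
Proof.
elim: n f g => [|n IHn] f g fh; first by rewrite ex_dprod0 ex_ret.
rewrite ex_dprodS ex_dseqS -(fh ord0); apply: eq_ex => a.
by rewrite -(IHn (fun i => f (lift ord0 i))).
Qed.

Lemma ex_dprod_dbits n gamma (g : seq (seq bool) -> R) :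
  ex (dprod (fun _ : 'I_n => dbits R gamma)) (fun s => g (map val s)) =
  ex (dseq (dseq (dflip R) gamma) n) g.
Proof. by apply: ex_dprod_marginal => i k; rewrite -ex_dbits. Qed.

Lemma ex_dflip (g : bool -> R) : ex (dflip R) g = 2^-1 * (g true + g false).
Proof. by rewrite ex_unif card_bool big_bool. Qed.

Lemma ex_dshare_fst b (k : bool -> R) :
  ex (dshare R b) (fun e => k e.1) = ex (dflip R) k.
Proof. by rewrite ex_bind; apply: eq_ex => a; rewrite ex_ret. Qed.

Lemma ex_dshare_snd b (k : bool -> R) :
  ex (dshare R b) (fun e => k e.2) = ex (dflip R) k.
Proof.
rewrite ex_bind !ex_dflip !ex_ret /=.
by case: b => //=; rewrite addrC.
Qed.

(* [Some w] stands for a known value, [None] for the next element of [u]. *)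
Fixpoint merge_seq (m : seq (option (seq bool))) (u : seq (seq bool)) :=
  match m with
  | [::] => [::]
  | Some w :: m' => w :: merge_seq m' u
  | None :: m' => head [::] u :: merge_seq m' (behead u)
  end.

Lemma merge_seq_filter (I : Type) (b : pred I) (s t : I -> seq bool) J :
  (forall i, b i -> s i = t i) ->
  merge_seq [seq if b i then Some (s i) else None | i <- J]
            [seq t i | i <- J & ~~ b i] = [seq t i | i <- J].
Proof.
by move=> st; elim: J => //= i J IHJ; case: ifP => bi; rewrite /= ?(st _ bi) IHJ.
Qed.

Definition masked (b : seq bool) (ws : seq (seq bool)) :=
  [seq if p.1 then Some p.2 else None | p <- zip b ws].

(** Each position receives exactly one fresh sample, from [ws] where [b] holds and from [u]
    elsewhere; the samples of [ws] that are not selected integrate out. *)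
Lemma ex_merge_seq (mu : dist R (seq bool)) b (g : seq (seq bool) -> R) :
  ex (dseq mu (size b)) (fun ws =>
    ex (dseq mu (count negb b)) (fun u => g (merge_seq (masked b ws) u))) =
  ex (dseq mu (size b)) g.
Proof.
elim: b g => [|b0 b IHb] g; first by rewrite /= !ex_ret.
rewrite [size _]/= !ex_dseqS; case: b0 => /=.
  by apply: eq_ex => a; apply: (IHb (fun t => g (a :: t))).
rewrite ex_cst; under eq_ex do rewrite (ex_dseqS mu (count negb b)).
by rewrite ex_swap; apply: eq_ex => a; apply: (IHb (fun t => g (a :: t))).
Qed.

(** * Collisions with uniform strings *)

Fixpoint collide (ss us : seq (seq bool)) : bool :=
  match ss, us with
  | s :: ss', u :: us' => (s == u) || collide ss' us'
  | _, _ => false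
  end.

Lemma collide_map (I : Type) (f g : I -> seq bool) J :
  collide (map f J) (map g J) = has (fun i => f i == g i) J.
Proof. by elim: J => //= i J ->. Qed.

Lemma ex_dseq_eq n (s : seq bool) :
  ex (dseq (dflip R) n) (fun t => (s == t)%:R) <= (2 ^+ n)^-1.
Proof.
elim: n s => [|n IHn] s.
  by rewrite ex_ret expr0 invr1; case: eqP; rewrite ?ler01 ?lexx.
(* Only the value of the first bit equal to the head of [s] contributes; the default [~~ b] makes
   both factors vanish when [s] is empty. *)
have H b : ex (dseq (dflip R) n) (fun t => (s == b :: t)%:R) <=
    ((head (~~ b) s == b)%:R) * (2 ^+ n)^-1.
  case: s => [|a s] /=.
    rewrite -(@ex_cst _ _ (dseq (dflip R) n) (_ * _)); apply: ler_ex => t.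
    by rewrite mulr_ge0 // invr_ge0 exprn_ge0.
  under eq_ex do rewrite eqseq_cons; case: (a == b) => /=.
    by rewrite mul1r; apply: IHn.
  by rewrite mul0r -(ex_cst (dseq (dflip R) n) 0) //; apply: ler_ex.
rewrite ex_dseqS ex_dflip exprS invfM ler_wpM2l ?invr_ge0 ?ler0n //.
apply: le_trans (lerD (H true) (H false)) _.
rewrite -mulrDl ler_piMl ?invr_ge0 ?exprn_ge0 //.
by case: s {H} => [|[] s] /=; rewrite ?addr0 ?add0r.
Qed.

(** Union bound over the positions, each contributing at most [1 / 2 ^ gamma]. *)
Lemma ex_collide n gamma ss :
  ex (dseq (dseq (dflip R) gamma) n) (fun us => (collide ss us)%:R) <=
  n%:R / 2 ^+ gamma.
Proof.
elim: n ss => [|n IHn] ss.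
  by rewrite ex_ret mul0r; case: ss.
rewrite ex_dseqS -natr1 mulrDl mul1r addrC.
apply: (@le_trans _ _ (ex (dseq (dflip R) gamma) (fun a => (head [::] ss == a)%:R
    + ex (dseq (dseq (dflip R) gamma) n) (fun t => (collide (behead ss) t)%:R)))).
  apply: ler_ex => a.
  rewrite -[X in _ <= X + _](ex_cst (dseq (dseq (dflip R) gamma) n)) -exD.
  apply: ler_ex => t; case: ss => [|s ss] /=; first by rewrite addr_ge0.
  by rewrite -natrD ler_nat; case: eqP; case: collide.
by rewrite exD ex_cst lerD // ex_dseq_eq.
Qed.

End Products.

(** * Trees encoding lists *)

Section Encodings.

Definition tlist : seq tree -> tree := foldr TCons TNil.

Lemma enc_map (T U : Type) (eT : encodable T) (eU : encodable U) (h : T -> U) s :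
  (forall x, eU (h x) = eT x) -> enc_seq eU (map h s) = enc_seq eT s.
Proof. by move=> hE; elim: s => //= x s; rewrite /enc_seq /enc /= hE => ->. Qed.

Lemma enc_map_val n (s : seq (bits n)) : enc (map val s) = enc s.
Proof. exact: enc_map. Qed.

Lemma spine_unary n : spine (enc n) = n.
Proof. by elim: n => //= n ->. Qed.

Definition mask_tree (m : seq (option (seq bool))) : tree :=
  tlist [seq if o is Some w then TCons TNil (enc w) else TNil | o <- m].

Lemma merge_treeE m (u acc : seq (seq bool)) :
  merge_tree (mask_tree m) (enc u) (enc acc) = enc (catrev (merge_seq m u) acc).
Proof.
elim: m u acc => [|[w|] m IHm] u acc //=.
  exact: (IHm u (w :: acc)).
(* Past the end of [u] both sides yield the empty word, which is encoded by [TNil]. *)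
case: u => [|w u]; first exact: (IHm [::] ([::] :: acc)).
exact: (IHm u (w :: acc)).
Qed.

(** A tree with a single path spelling [w]: a word that leaves the path falls into [TNil] and stays
    there, so equality is tested by one descent. *)
Fixpoint trie (w : seq bool) : tree :=
  match w with
  | [::] => TCons TNil TNil
  | true :: w' => TCons (trie w') TNil
  | false :: w' => TCons TNil (trie w')
  end.

Lemma walk_trie_TNil w : walk_trie TNil w = TNil.
Proof. by elim: w => //= b _ w IHw; rewrite if_same. Qed.

(** Equal lengths matter: a proper prefix of [s] would also stop at a node other than [TNil]. *)
Lemma walk_trieE (s w : seq bool) :
  size s = size w -> truth (walk_trie (trie s) (enc w)) = (s == w).
Proof.
elim: s w => [|a s IHs] [|b w] //= [/IHs].
by rewrite eqseq_cons; case: a; case: b => //=; rewrite walk_trie_TNil.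
Qed.

Lemma some_match_TNil w : some_match TNil w = false.
Proof. by elim: w => //= w1 _ w ->; rewrite walk_trie_TNil. Qed.

Lemma some_matchE n (ss us : seq (bits n)) :
  some_match (tlist [seq trie (val s) | s <- ss]) (enc us) =
  collide (map val ss) (map val us).
Proof.
elim: ss us => [|s ss IHs] [|u us] //=; first exact: (some_match_TNil (enc (u :: us))).
by rewrite -IHs -walk_trieE ?size_tuple.
Qed.

Lemma tree_size_seq T (eT : encodable T) (s : seq T) k :
  (forall x, tree_size (eT x) <= k)%N -> (tree_size (enc s) <= size s * k.+1 + 1)%N.
Proof.
by move=> sk; elim: s => //= x s IHs; have := sk x; rewrite -/(enc s) /enc in IHs *; lia.
Qed.

Lemma tree_size_tlist s k :
  all (fun v => tree_size v <= k)%N s -> (tree_size (tlist s) <= size s * k.+1 + 1)%N.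
Proof. by elim: s => //= x s IHs /andP[sk /IHs]; lia. Qed.

Lemma tree_size_bits n (s : bits n) : (tree_size (enc s) <= n * 4 + 1)%N.
Proof. by rewrite -[X in (X * _)%N](size_tuple s); apply: tree_size_seq; case. Qed.

Lemma tree_size_trie w : tree_size (trie w) = (size w * 2 + 3)%N.
Proof. by elim: w => //= -[] w /=; lia. Qed.

End Encodings.

(** * Distinguishing advantage *)

Section Advantage.
Variable R : realType.

Definition accept (D : ppt R) (a v : tree) : R :=
  ex (apply D (TCons a v)) (fun w => (truth w)%:R).

Lemma accept_itv01 D a v : 0 <= accept D a v <= 1.
Proof. by apply: ex_itv01 => w; rewrite ler0n lern1 leq_b1. Qed.

Lemma advantageE D a (mu nu : dist R tree) :
  advantage D a mu nu = `|ex mu (accept D a) - ex nu (accept D a)|.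
Proof. by rewrite /advantage !prE !ex_bind. Qed.

(* The advice for an index of the original ensemble is taken from the worst
   point of its fibre under [phi]. *)
Lemma indist_reindex (I : nat -> nat -> Type)
    (valid : forall lambda sigma, I lambda sigma -> Prop)
    (mu nu : forall lambda sigma, I lambda sigma -> dist R tree)
    (J : nat -> nat -> finType) (vJ : forall lambda sigma, J lambda sigma -> Prop)
    (phi : forall lambda sigma, J lambda sigma -> I lambda sigma)
    (b : forall lambda sigma, J lambda sigma -> tree)
    (p : nat -> nat -> nat) (D : ppt R) :
  indist valid mu nu -> poly_bounded p ->
  (forall lambda sigma j, vJ lambda sigma j ->
     valid lambda sigma (phi lambda sigma j) /\
     (tree_size (b lambda sigma j) <= p lambda sigma)%N) ->
  exists f g : nat -> R, negligible f /\ negligible g /\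
    forall lambda sigma j, vJ lambda sigma j ->
      advantage D (b lambda sigma j) (mu lambda sigma (phi lambda sigma j))
                  (nu lambda sigma (phi lambda sigma j)) <= f lambda + g sigma.
Proof.
move=> munu p_poly vb.
pose fibre l s i : pred (J l s) := fun j => `[< vJ l s j /\ phi l s j = i >].
pose a l s i := if [pick j | fibre l s i j] isn't Some j0 then TNil else
  b l s [arg max_(j > j0 | fibre l s i j) advantage D (b l s j) (mu l s i) (nu l s i)]%O.
(* The added 1 is the size of [TNil], the advice given where the fibre is empty. *)
have p1_poly : poly_bounded (fun l s => p l s + 1)%N.
  apply: pbd_poly_bounded; apply: pbdD; [exact: poly_bounded_pbd|exact: pbd_cst].
have [|f [g [nf [ng fg]]]] := munu D a _ p1_poly.
  move=> l s i _; rewrite /a; case: pickP => [j0 j0i|_]; last by rewrite addn1.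
  case: arg_maxP => // j /asboolP[vj _] _.
  by rewrite (leq_trans (vb _ _ _ vj).2) ?leq_addr.
exists f, g; split=> //; split=> // l s j vj.
apply: le_trans (fg l s (phi l s j) (vb _ _ _ vj).1); rewrite /a.
have jj : fibre l s (phi l s j) j by apply/asboolP.
case: pickP => [j0 j0i|/(_ j)]; last by rewrite jj.
by case: arg_maxP => // j' _; apply.
Qed.

(** * Negligible functions *)

Lemma negligible0 : negligible (fun=> 0 : R).
Proof.
by move=> c; exists 0%N => n _; rewrite normr0 invr_ge0 exprn_ge0 ?ler0n.
Qed.

(** With [k = c + 1], [n < k * (n %/ k + 1) <= k * 2 ^ (n %/ k)] gives [n ^ k <= k ^ k * 2 ^ n]; for
    [n > k ^ k] one factor [n] cancels against [k ^ k]. *)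
Lemma negligible_exp2V : negligible (fun n => (2 ^+ n)^-1 : R).
Proof.
move=> c; pose k := c.+1; exists (k ^ k)%N => n kn.
have n_gt0 : (0 < n)%N by lia.
have nk : (n ^ k <= k ^ k * 2 ^ n)%N.
  have : (n ^ k <= (k * (n %/ k).+1) ^ k)%N.
    by rewrite leq_exp2r // mulnC ltnW // ltn_ceil.
  move/leq_trans; apply; rewrite expnMn leq_mul2l; apply/orP; right.
  apply: (@leq_trans ((2 ^ (n %/ k)) ^ k)); first by rewrite leq_exp2r // ltn_expl.
  by rewrite -expnM leq_pexp2l // leq_trunc_div.
have nc : (n ^ c <= 2 ^ n)%N.
  rewrite -(leq_pmul2l n_gt0) -expnS (leq_trans nk) // leq_mul2r ltnW ?orbT //.
rewrite ger0_norm ?invr_ge0 ?exprn_ge0 ?ler0n //.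
rewrite lef_pV2 ?posrE ?exprn_gt0 ?ltr0n // -!natrX.
by rewrite ler_nat.
Qed.

Lemma negligibleD (f g : nat -> R) :
  negligible f -> negligible g -> negligible (fun n => f n + g n).
Proof.
(* Each summand is bounded with exponent [c + 1], and the spare factor [1 / n <= 1 / 2] absorbs the
   sum of two terms. *)
move=> nf ng c; have [N1 H1] := nf c.+1; have [N2 H2] := ng c.+1.
exists (maxn (maxn N1 N2) 1) => n; rewrite !gtn_max -andbA => /and3P[n1 n2' n3].
apply: le_trans (ler_normD _ _) _.
apply: le_trans (lerD (H1 _ n1) (H2 _ n2')) _.
have n_gt0 : 0 < n%:R :> R by rewrite ltr0n; lia.
rewrite exprS invfM -mulrDl ler_piMl ?invr_ge0 ?exprn_ge0 ?ler0n //.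
have n2 : n%:R^-1 <= 2^-1 :> R by rewrite lef_pV2 ?posrE // ler_nat.
lra.
Qed.

End Advantage.

(** The hypothesis says that [s + log2 n <= g]; multiplied by [ln 2] and exponentiated, it becomes
    [2 ^ s * n <= 2 ^ g]. *)
Lemma exp2_ge (R : realType) (n s g : nat) : (0 < n)%N ->
  s%:R + ln n%:R / ln 2 <= g%:R :> R -> n%:R / 2 ^+ g <= (2 ^+ s)^-1 :> R.
Proof.
move=> n0 h; have ln2 : 0 < ln (2 : R) by apply: ln_gt0; rewrite ltr1n.
have {h} : s%:R * ln 2 + ln n%:R <= g%:R * ln 2 :> R.
  by move: h; rewrite -(ler_pM2r ln2) mulrDl divfK // gt_eqF.
have p2 k : 0 < 2 ^+ k :> R by rewrite exprn_gt0 ?ltr0n.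
move=> h; have {h} : 2 ^+ s * n%:R <= 2 ^+ g :> R.
  move: h; rewrite !mulr_natl -!lnXn ?ltr0n // -lnM ?posrE ?ltr0n //.
  by rewrite ler_ln ?posrE ?mulr_gt0 ?ltr0n.
by move=> h; rewrite ler_pdivrMr // ler_pdivlMl.
Qed.

(** * The protocol *)

Section Protocol.
Variables (R : realType) (B l gamma kappa : nat -> nat -> nat).
Variable P : pprf_family R B l gamma kappa.

Section Inputs.
Variables lambda sigma : nat.
Local Notation n := (B lambda sigma).
Local Notation ell := (l lambda sigma).
Local Notation gam := (gamma lambda sigma).
Implicit Types (X : n.-tuple {set bits ell}) (x : n.-tuple (bits ell))
  (s : n.-tuple (bits gam)).

Definition copies X s : n.-tuple (seq (bits gam)) :=
  [tuple nseq #|tnth X i| (tnth s i) | i < n].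

Definition member X x : pred 'I_n := fun i => tnth x i \in tnth X i.

(* Decreasing order, since the merging program outputs a reversed list. *)
Definition outside X x : seq 'I_n := [seq i <- rev (enum 'I_n) | ~~ member X x i].

Definition queries X x : seq ('I_n * bits ell) :=
  [seq (i, tnth x i) | i <- outside X x].

Definition secret_mask X x s : seq (option (seq bool)) :=
  [seq if member X x i then Some (val (tnth s i)) else None | i <- rev (enum 'I_n)].

(** Advice of the collision test: the secrets at the non-members, in the order of the queries. *)
Definition secret_tries X x s : tree :=
  tlist [seq trie (val w) | w <- [seq tnth s i | i <- outside X x]].

Lemma size_queries X x : (size (queries X x) <= n)%N.
Proof.
rewrite size_map size_filter (leq_trans (count_size _ _)) //.
by rewrite size_rev size_enum_ord.
Qed.

Lemma valid_queries (m : nat -> nat -> nat) X x s :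
  disjoint_sets X -> small_sets (m lambda sigma) X ->
  @valid_query m B B l gamma lambda sigma (X, copies X s, queries X x).
Proof.
move=> dX sX; split=> //.
- by move=> i; rewrite tnth_mktuple size_nseq.
- split; last exact: size_queries.
  rewrite map_inj_uniq => [|i j []//].
  by rewrite filter_uniq // rev_uniq enum_uniq.
by apply/allP => p /mapP[i]; rewrite mem_filter => /andP[ni _] ->.
Qed.

(** All values programmed for index [i] are the same secret, so the rank of the element within its
    set does not matter. *)
Lemma agrees_member X x s (k : n.-tuple (bits (kappa lambda sigma))) F i :
  agrees k X (copies X s) F -> member X x i ->
  F (tnth k i) (tnth x i) = tnth s i.
Proof.
move=> /forallP/(_ i)/forallP agr xi.
have xX : tnth x i \in tnth X i := xi.
have := agr (enum_rank_in xX (tnth x i)).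
rewrite enum_rankK_in // => /eqP ->.
by rewrite tnth_mktuple nth_nseq ltn_ord.
Qed.

Lemma ex_Pi X x (g : seq bool -> seq bool -> n.-tuple (bits gam) ->
    n.-tuple (bits gam) -> R)
    (h : execution (n.-tuple bool) (n.-tuple bool)
           (sender_view B l gamma lambda sigma)
           (receiver_view B l gamma lambda sigma) -> R) :
  (forall (eS eR : n.-tuple bool) s t,
     h (Execution eS eR (X, s, eS) (x, tt, (t, eR))) = g eS eR s t) ->
  ex (Pi_bssPMT (F_bOPPRF P) (F_ssPEQT R) X x) h =
  ex (dprod (fun=> dbits R gam)) (fun s =>
    ex (F_bOPPRF P X (copies X s) x) (fun t =>
      ex (dprod (fun i => dshare R (tnth s i == tnth t i))) (fun e =>
        g (map fst e) (map snd e) s t))).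
Proof.
move=> hg; rewrite /Pi_bssPMT ex_bind; apply: eq_ex => s.
rewrite ex_bind; apply: eq_ex => t; rewrite ex_bind; apply: eq_ex => e.
by rewrite ex_ret hg.
Qed.

Lemma ex_F X x (g : seq bool -> seq bool -> R)
    (h : n.-tuple bool * n.-tuple bool -> R) :
  (forall eS eR : n.-tuple bool, h (eS, eR) = g eS eR) ->
  ex (@F_bssPMT R B l _ _ X x) h =
  ex (dprod (fun i => dshare R (member X x i))) (fun e =>
    g (map fst e) (map snd e)).
Proof.
by move=> hg; rewrite ex_bind; apply: eq_ex => e; rewrite ex_ret hg.
Qed.

(** For a fixed [s], [real_queries] and [unif_queries] are the two sides of the pseudorandomness of
    [P] on the inputs that are not programmed. *)
Definition real_queries X x s : dist R tree :=
  k <-$ dprod (fun=> dbits R (kappa lambda sigma));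
  F <-$ P k X (copies X s);
  dret R (enc [seq F (tnth k p.1) p.2 | p <- queries X x]).

Definition unif_queries X x : dist R tree :=
  u <-$ dprod (fun _ : 'I_(size (queries X x)) => dbits R gam);
  dret R (enc u).

(** Almost surely the outputs at members are the secrets, so a test of the whole vector becomes a
    test of the answers to the queries. *)
Lemma ex_bOPPRF X x s (g : n.-tuple (bits gam) -> R) (h : tree -> R) :
  (forall k, pr (P k X (copies X s)) (agrees k X (copies X s)) = 1) ->
  (forall t : n.-tuple (bits gam), (forall i, member X x i -> tnth t i = tnth s i) ->
     g t = h (enc [seq tnth t i | i <- outside X x])) ->
  ex (F_bOPPRF P X (copies X s) x) g = ex (real_queries X x s) h.
Proof.
move=> prog gh; rewrite !ex_bind; apply: eq_ex => k; rewrite !ex_bind.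
apply: (eq_ex_pr1 (prog k)) => F agr; rewrite !ex_ret gh => [|i xi].
  rewrite -map_comp; congr (h (enc _)); apply: eq_map => i /=.
  by rewrite tnth_mktuple.
by rewrite tnth_mktuple; apply: agrees_member agr xi.
Qed.

Lemma merge_secrets X x s (t : n.-tuple (bits gam)) :
  (forall i, member X x i -> tnth t i = tnth s i) ->
  merge_tree (mask_tree (secret_mask X x s))
    (enc [seq tnth t i | i <- outside X x]) TNil = enc t.
Proof.
move=> ts; rewrite -enc_map_val (merge_treeE _ _ [::]) -map_comp.
rewrite (merge_seq_filter (t := val \o tnth t)); last by move=> i /ts /= ->.
rewrite -[catrev _ _]/(rev _) map_rev revK (map_comp val) map_tnth_enum.
exact: enc_map_val.
Qed.

(** Secrets at members and independent uniform values elsewhere form together a uniform vector: this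
    turns the simulated OPPRF outputs into an output of the reduction. *)
Lemma merge_unif X x (g : tree -> R) :
  ex (dprod (fun=> dbits R gam)) (fun s =>
    ex (unif_queries X x) (fun u =>
      g (merge_tree (mask_tree (secret_mask X x s)) u TNil))) =
  ex (dprod (fun _ : 'I_n => dbits R gam)) (fun t => g (enc t)).
Proof.
pose b := [seq member X x i | i <- rev (enum 'I_n)].
have sb : size b = n by rewrite size_map size_rev size_enum_ord.
have sq : size (queries X x) = count negb b.
  by rewrite size_map size_filter count_map.
transitivity (ex (dseq (dseq (dflip R) gam) n) (fun t => g (enc t))); last first.
  rewrite -ex_dprod_dbits; apply: eq_ex => t; by rewrite enc_map_val.
(* The first reversal undoes the accumulator, the second one aligns the secrets with the decreasing
   order of the mask. *)
rewrite -[RHS]ex_dseq_rev -[X in _ = ex (dseq _ X) _]sb -ex_merge_seq sb -sq.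
rewrite -[RHS]ex_dseq_rev -[RHS]ex_dprod_dbits.
apply: eq_ex => s /=; rewrite ex_bind -ex_dprod_dbits; apply: eq_ex => u.
rewrite ex_ret -[enc u]/(enc (tval u)) -enc_map_val (merge_treeE _ _ [::]).
rewrite -[catrev _ _]/(rev _) /=; congr (g (enc (rev (merge_seq _ _)))).
rewrite /masked /secret_mask /b.
have -> : rev [seq val w | w <- s] =
    [seq val (tnth s i) | i <- rev (enum 'I_n)].
  by rewrite -[in LHS](map_tnth_enum s) -map_comp map_rev.
by rewrite zip_map -map_comp; apply: eq_map.
Qed.

Lemma ex_unif_match X x s :
  ex (unif_queries X x) (fun u => (some_match (secret_tries X x s) u)%:R) <=
  n%:R / 2 ^+ gam.
Proof.
rewrite ex_bind; under eq_ex do rewrite ex_ret /secret_tries some_matchE.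
rewrite (@ex_dprod_dbits R _ _ (fun us => (collide _ us)%:R)).
apply: le_trans (@ex_collide R _ _ _) _.
by rewrite ler_wpM2r ?invr_ge0 ?exprn_ge0 ?ler0n // ler_nat size_queries.
Qed.

Lemma tree_size_tries X x s :
  (tree_size (secret_tries X x s) <= n * (gam * 2 + 4) + 1)%N.
Proof.
apply: leq_trans (tree_size_tlist (k := gam * 2 + 3) _) _.
  rewrite all_map; apply/allP => w _ /=.
  by rewrite tree_size_trie size_tuple.
rewrite !size_map; have := size_queries X x; rewrite size_map.
by rewrite leq_add2r -addnS leq_mul2r => ->; rewrite orbT.
Qed.

Lemma tree_size_mask X x s :
  (tree_size (mask_tree (secret_mask X x s)) <= n * (gam * 4 + 4) + 1)%N.
Proof.
apply: leq_trans (tree_size_tlist (k := gam * 4 + 3) _) _.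
  rewrite all_map; apply/allP => o /mapP[i _ ->] /=; case: ifP => _ /=; last by lia.
  rewrite addn3 add1n !ltnS -addn1; exact: (tree_size_bits (tnth s i)).
by rewrite !size_map size_rev size_enum_ord -addnS.
Qed.

(** * Real and ideal executions *)

Definition programs X := forall s k,
  pr (P k X (copies X s)) (agrees k X (copies X s)) = 1.

(** Both executions share a vector of bits: equality of [s] and [t] in one, membership in the other.
    At members [t] equals [s], so the vectors differ only if some value outside collides with its
    secret; the gap is at most the probability of this event. *)
Lemma Pi_F_gap X x (h : seq bool -> seq bool -> R) :
  programs X -> (forall eS eR, 0 <= h eS eR <= 1) ->
  `|ex (Pi_bssPMT (F_bOPPRF P) (F_ssPEQT R) X x) (fun e => h (out_S e) (out_R e)) -
    ex (@F_bssPMT R B l _ _ X x) (fun o => h o.1 o.2)| <=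
  ex (dprod (fun=> dbits R gam)) (fun s =>
    ex (real_queries X x s) (fun u => (some_match (secret_tries X x s) u)%:R)).
Proof.
move=> prog h01.
rewrite (@ex_Pi X x (fun eS eR _ _ => h eS eR)) // (@ex_F X x h) //.
pose A b := ex (dprod (fun i : 'I_n => dshare R (b i)))
               (fun e => h (map fst e) (map snd e)).
have A01 b : 0 <= A b <= 1 by apply: ex_itv01.
have AB b b' : `|A b - A b'| <= (~~ [forall i, b i == b' i])%:R.
  have [/forallP bb'|_] := boolP [forall i, b i == b' i].
    suff -> : b = b' by rewrite subrr normr0.
    by apply/funext => i; apply/eqP.
  have /andP[? ?] := A01 b; have /andP[? ?] := A01 b'.
  by rewrite (_ : _%:R = 1) // ler_norml; apply/andP; split; lra.
rewrite -/(A (member X x)) -[X in _ - X](ex_cst (dprod (fun _ : 'I_n => dbits R gam))).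
rewrite -exB; apply: le_trans (ler_norm_ex _ _) _; apply: ler_ex => s.
rewrite -[X in _ - X](ex_cst (F_bOPPRF P X (copies X s) x)) -exB.
apply: le_trans (ler_norm_ex _ _) _; apply: le_trans (ler_ex _ (fun t => AB _ _)) _.
rewrite le_eqVlt; apply/orP; left; apply/eqP.
apply: ex_bOPPRF => [k|t ts]; first exact: prog.
rewrite /secret_tries some_matchE -!map_comp collide_map; congr (_%:R).
congr nat_of_bool; apply/idP/hasP => [/forallPn[i]|[i]].
  have [xi|nxi] := boolP (member X x i); first by rewrite ts ?eqxx.
  rewrite eqbF_neg negbK => st; exists i => //.
  by rewrite mem_filter nxi mem_rev mem_enum.
rewrite mem_filter => /andP[nxi _] st; apply/forallPn; exists i.
by rewrite (negbTE nxi) eqbF_neg negbK.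
Qed.

(** The receiver's shares are uniform and independent of [s] and [t], and [t] is recovered by
    merging. The secrets and shares are thus drawn outside of the PPRF experiment and can be
    fixed. *)
Lemma ex_Pi_receiver X x (h : seq bool -> tree -> R)
    (h' : execution (n.-tuple bool) (n.-tuple bool)
           (sender_view B l gamma lambda sigma)
           (receiver_view B l gamma lambda sigma) -> R) :
  programs X ->
  (forall (eS eR : n.-tuple bool) s (t : n.-tuple (bits gam)),
     h' (Execution eS eR (X, s, eS) (x, tt, (t, eR))) = h eR (enc t)) ->
  ex (Pi_bssPMT (F_bOPPRF P) (F_ssPEQT R) X x) h' =
  ex (dprod (fun _ : 'I_n => dbits R gam)) (fun s =>
    ex (dprod (fun _ : 'I_n => dflip R)) (fun a =>
      ex (real_queries X x s) (fun u =>
        h a (merge_tree (mask_tree (secret_mask X x s)) u TNil)))).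
Proof.
move=> prog hE; rewrite (@ex_Pi X x (fun _ eR _ t => h eR (enc t))) //.
apply: eq_ex => s; rewrite [RHS]ex_swap.
apply: ex_bOPPRF => [k|t ts]; first exact: prog.
rewrite (@ex_dprod_marginal _ _ _ snd (dflip R) _ _ (fun e => h e (enc t))).
  by rewrite -ex_dprod_dseq merge_secrets.
by move=> i k; apply: ex_dshare_snd.
Qed.

(** The sender's shares are uniform whatever bits are shared, so the OPPRF outputs integrate out. *)
Lemma ex_Pi_sender X x (h : seq bool -> tree -> R)
    (h' : execution (n.-tuple bool) (n.-tuple bool)
           (sender_view B l gamma lambda sigma)
           (receiver_view B l gamma lambda sigma) -> R) :
  (forall (eS eR : n.-tuple bool) s (t : n.-tuple (bits gam)),
     h' (Execution eS eR (X, s, eS) (x, tt, (t, eR))) = h eS (enc s)) ->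
  ex (Pi_bssPMT (F_bOPPRF P) (F_ssPEQT R) X x) h' =
  ex (dseq (dflip R) n) (fun a =>
    ex (dseq (dseq (dflip R) gam) n) (fun t => h a (enc t))).
Proof.
move=> hE; rewrite (@ex_Pi X x (fun eS _ s _ => h eS (enc s))) // [RHS]ex_swap.
rewrite -ex_dprod_dbits; apply: eq_ex => s; rewrite enc_map_val.
rewrite -[RHS](ex_cst (F_bOPPRF P X (copies X s) x)); apply: eq_ex => t.
apply: (@ex_dprod_marginal _ _ _ fst (dflip R) _ _ (fun e => h e (enc (tval s)))) => i k.
exact: ex_dshare_fst.
Qed.

(** Puts the simulated view in the form of the real one, with uniform answers in place of those of
    the PPRF. *)
Lemma ex_F_receiver X x (h : seq bool -> tree -> R) :
  ex (@F_bssPMT R B l _ _ X x) (fun o =>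
    ex (dseq (dseq (dflip R) gam) n) (fun t => h o.2 (enc t))) =
  ex (dprod (fun _ : 'I_n => dbits R gam)) (fun s =>
    ex (dprod (fun _ : 'I_n => dflip R)) (fun a =>
      ex (unif_queries X x) (fun u =>
        h a (merge_tree (mask_tree (secret_mask X x s)) u TNil)))).
Proof.
rewrite [RHS]ex_swap.
rewrite (@ex_F X x (fun _ eR =>
  ex (dseq (dseq (dflip R) gam) n) (fun t => h eR (enc t)))) //.
rewrite (@ex_dprod_marginal _ _ _ snd (dflip R) _ _ (fun e =>
  ex (dseq (dseq (dflip R) gam) n) (fun t => h e (enc t)))); last first.
  by move=> i k; apply: ex_dshare_snd.
rewrite -ex_dprod_dseq; apply: eq_ex => a; rewrite (merge_unif _ _ (h a)).
rewrite -ex_dprod_dbits; apply: eq_ex => t; by rewrite enc_map_val.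
Qed.

Lemma ex_F_sender X x (h : seq bool -> R) :
  ex (@F_bssPMT R B l _ _ X x) (fun o => h o.1) = ex (dseq (dflip R) n) h.
Proof.
rewrite (@ex_F X x (fun eS _ => h eS)) //.
by apply: ex_dprod_marginal => i k; apply: ex_dshare_fst.
Qed.

End Inputs.

End Protocol.

(** * Reductions to the pseudorandomness of the PPRF *)

Section Security.
Variables (R : realType) (B l gamma kappa m : nat -> nat -> nat).
Hypothesis B_poly : poly_bounded B.
Hypothesis l_poly : poly_bounded l.
Hypothesis gamma_poly : poly_bounded gamma.
Hypothesis B_gt0 : forall lambda sigma, (0 < B lambda sigma)%N.
Hypothesis gamma_ge : forall lambda sigma : nat,
  sigma%:R + ln (B lambda sigma)%:R / ln 2 <= (gamma lambda sigma)%:R :> R.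
Variable P : pprf_family R B l gamma kappa.
Hypothesis P_pprf : programmable_prf m P.

Lemma pprf_programs lambda sigma (X : (B lambda sigma).-tuple _) :
  disjoint_sets X -> small_sets (m lambda sigma) X -> programs P X.
Proof.
by move=> dX sX s k; apply: P_pprf.1 => // i; rewrite tnth_mktuple size_nseq.
Qed.

Lemma correctness : indist (@bssPMT_valid m B l)
  (fun lambda sigma i => e <-$ Pi_bssPMT (F_bOPPRF P) (F_ssPEQT R) i.1 i.2;
     dret R (enc (out_S e, out_R e)))
  (fun lambda sigma i => o <-$ @F_bssPMT R B l lambda sigma i.1 i.2;
     dret R (enc o)).
Proof.
move=> D a p p_poly ap.
have [T TE] := match_ppt R.
(* The secrets belong to the index: each fixed choice determines the programming and the advice of
   the collision test. *)
pose J lambda sigma : finType :=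
  ((B lambda sigma).-tuple {set bits (l lambda sigma)} *
   (B lambda sigma).-tuple (bits (l lambda sigma)) *
   (B lambda sigma).-tuple (bits (gamma lambda sigma)))%type.
have tries_poly : poly_bounded (fun l s => B l s * (gamma l s * 2 + 4) + 1)%N.
  apply: pbd_poly_bounded; apply: pbdD; last exact: pbd_cst.
  apply: pbdM; first exact: poly_bounded_pbd.
  apply: pbdD; last exact: pbd_cst.
  by apply: pbdM; [exact: poly_bounded_pbd | exact: pbd_cst].
(* There is at most one query per batch index, whence the query bound [B]. *)
have [|f [g [nf [ng fg]]]] := @indist_reindex R _ _ _ _ J
    (fun lambda sigma j => bssPMT_valid m j.1)
    (fun lambda sigma j => (j.1.1, copies j.1.1 j.2, queries j.1.1 j.1.2))
    (fun lambda sigma j => secret_tries j.1.1 j.1.2 j.2)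
    _ T (P_pprf.2 B B_poly) tries_poly.
  move=> lambda sigma [[X x] s] [dX sX]; split; first exact: valid_queries.
  exact: tree_size_tries.
(* The added term bounds the collisions of uniform values. *)
exists f, (fun n => g n + (2 ^+ n)^-1); split=> //; split.
  by apply: negligibleD => //; apply: negligible_exp2V.
move=> lambda sigma [X x] [/= dX sX].
rewrite advantageE ex_bind [X in _ - X]ex_bind.
pose (h := fun eS eR : seq bool =>
  accept D (a lambda sigma (X, x)) (TCons (enc eS) (enc eR))).
rewrite [X in `|X - _|](_ : _ = ex (Pi_bssPMT (F_bOPPRF P) (F_ssPEQT R) X x)
  (fun e => h (out_S e) (out_R e))); last by apply: eq_ex => e; rewrite ex_ret.
rewrite [X in `|_ - X|](_ : _ = ex (@F_bssPMT R B l _ _ X x)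
  (fun o => h o.1 o.2)); last by apply: eq_ex => o; rewrite ex_ret.
have h01 eS eR : 0 <= h eS eR <= 1 by apply: accept_itv01.
apply: le_trans (Pi_F_gap x (pprf_programs dX sX) h01) _.
apply: (@le_trans _ _ (ex (dprod (fun=> dbits R (gamma lambda sigma))) (fun s =>
    ex (unif_queries R gamma X x) (fun u => (some_match (secret_tries X x s) u)%:R)
    + (f lambda + g sigma)))).
  (* [T] accepts exactly on a match, so for fixed [s] its advantage is the gap between the collision
     probabilities for real and for uniform answers. *)
  apply: ler_ex => s; rewrite -lerBlDl; apply: le_trans (fg _ _ (X, x, s) _) => //.
  rewrite advantageE; apply: le_trans (ler_norm _).
  rewrite le_eqVlt; apply/orP; left; apply/eqP.
  by congr (_ - _); apply: eq_ex => u; rewrite /accept TE /=; case: some_match.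
apply: (@le_trans _ _ (ex (dprod (fun _ : 'I_(B lambda sigma) =>
    dbits R (gamma lambda sigma))) (fun s =>
    (2 ^+ sigma)^-1 + (f lambda + g sigma)))).
  apply: ler_ex => s; rewrite lerD2r; apply: le_trans (ex_unif_match _ _ _ _) _.
  exact: exp2_ge.
by rewrite ex_cst addrC addrA.
Qed.

Lemma sender_privacy : exists Sim : ppt R, indist (@bssPMT_valid m B l)
  (fun lambda sigma i => e <-$ Pi_bssPMT (F_bOPPRF P) (F_ssPEQT R) i.1 i.2;
     dret R (TCons (enc (out_S e)) (enc (view_S e))))
  (fun lambda sigma i => o <-$ @F_bssPMT R B l lambda sigma i.1 i.2;
     v <-$ apply Sim (TCons (bssPMT_public B l gamma lambda sigma) (enc (i.1, o.1)));
     dret R (TCons (enc o.1) v)).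
Proof.
(* From the input [(public, (X, e_S))] the simulator outputs [((X, s), e_S)] with sampled [s]. *)
have [Sim SimE] := @sample_ppt R
  (ECons (ECons (EHd (ETl (EVar 0))) (EVar 3)) (ETl (ETl (EVar 0))))
  (fun v t => TCons (TCons (thd (ttl v)) t) (ttl (ttl v)))
  (fun _ _ _ _ _ _ _ => erefl).
exists Sim => D a p _ _.
(* The two laws coincide, so the advantage is zero. *)
exists (fun=> 0), (fun=> 0); split; [|split]; try exact: negligible0.
move=> lambda sigma [X x] _; rewrite advantageE ex_bind [X in _ - X]ex_bind.
pose (h := fun (eS : seq bool) v => accept D (a lambda sigma (X, x))
  (TCons (enc eS) (TCons (TCons (enc X) v) (enc eS)))).
rewrite (ex_Pi_sender P (h := h)) => [|eS eR s t]; last by rewrite ex_ret.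
rewrite [X in `|_ - X|](_ : _ = ex (@F_bssPMT R B l _ _ X x) (fun o =>
  ex (dseq (dseq (dflip R) (gamma lambda sigma)) (B lambda sigma))
     (fun t => h o.1 (enc t)))); last first.
  apply: eq_ex => o; rewrite ex_bind SimE.
  rewrite /third /fifth /= !spine_unary.
  by apply: eq_ex => t; rewrite ex_ret.
rewrite (ex_F_sender X x (fun e =>
  ex (dseq (dseq (dflip R) (gamma lambda sigma)) (B lambda sigma))
     (fun t => h e (enc t)))).
by rewrite subrr normr0 addr0.
Qed.

Lemma receiver_privacy : exists Sim : ppt R, indist (@bssPMT_valid m B l)
  (fun lambda sigma i => e <-$ Pi_bssPMT (F_bOPPRF P) (F_ssPEQT R) i.1 i.2;
     dret R (TCons (enc (out_R e)) (enc (view_R e))))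
  (fun lambda sigma i => o <-$ @F_bssPMT R B l lambda sigma i.1 i.2;
     v <-$ apply Sim (TCons (bssPMT_public B l gamma lambda sigma) (enc (i.2, o.2)));
     dret R (TCons (enc o.2) v)).
Proof.
(* From the input [(public, (x, e_R))] the simulator outputs [((x, tt), (t, e_R))] with sampled
   [t]. *)
have [Sim SimE] := @sample_ppt R
  (ECons (ECons (EHd (ETl (EVar 0))) ENil) (ECons (EVar 3) (ETl (ETl (EVar 0)))))
  (fun v t => TCons (TCons (thd (ttl v)) TNil) (TCons t (ttl (ttl v))))
  (fun _ _ _ _ _ _ _ => erefl).
exists Sim => D a p p_poly ap.
have [T TE] := merge_ppt D.
pose J lambda sigma : finType :=
  ((B lambda sigma).-tuple {set bits (l lambda sigma)} *
   (B lambda sigma).-tuple (bits (l lambda sigma)) *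
   (B lambda sigma).-tuple (bits (gamma lambda sigma)) *
   (B lambda sigma).-tuple bool)%type.
(* Sizes of the mask, of the distinguisher's advice, of the shares and of the inputs; the 6 counts
   three pairing nodes and three list ends. *)
pose q lambda sigma := (B lambda sigma * (gamma lambda sigma * 4 + 4) +
  p lambda sigma + B lambda sigma * 4 + B lambda sigma * (l lambda sigma * 4 + 2) + 6)%N.
have q_poly : poly_bounded q.
  have cst k := @pbd_cst _ secparam k.
  have [pB pl pg pp] := And4 (poly_bounded_pbd B_poly) (poly_bounded_pbd l_poly)
    (poly_bounded_pbd gamma_poly) (poly_bounded_pbd p_poly).
  by apply: pbd_poly_bounded; do ! (apply: pbdD || apply: pbdM || exact: cst || assumption).
have [|f [g [nf [ng fg]]]] := @indist_reindex R _ _ _ _ J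
    (fun lambda sigma j => bssPMT_valid m j.1.1)
    (fun lambda sigma j =>
       (j.1.1.1, copies j.1.1.1 j.1.2, queries j.1.1.1 j.1.1.2))
    (fun lambda sigma j =>
       TCons (mask_tree (secret_mask j.1.1.1 j.1.1.2 j.1.2))
         (TCons (a lambda sigma j.1.1) (TCons (enc j.2) (enc j.1.1.2))))
    _ T (P_pprf.2 B B_poly) q_poly.
  move=> lambda sigma [[[X x] s] e] [dX sX]; split; first exact: valid_queries.
  rewrite /= /q; have := tree_size_mask X x s.
  have := ap lambda sigma (X, x) (conj dX sX).
  have : (tree_size (enc e) <= B lambda sigma * 4 + 1)%N by exact: tree_size_bits.
  have : (tree_size (enc x) <= B lambda sigma * (l lambda sigma * 4 + 2) + 1)%N.
    have := @tree_size_seq _ _ (tval x) _ (@tree_size_bits (l lambda sigma)).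
    by rewrite size_tuple -addnS.
  move: (tree_size (enc x)) (tree_size (enc e)).
  move: (tree_size (a _ _ _)) (tree_size (mask_tree (secret_mask X x s))).
  lia.
exists f, g; split=> //; split=> // lambda sigma [X x] [/= dX sX].
rewrite advantageE ex_bind [X in _ - X]ex_bind.
pose (h := fun (e : seq bool) v => accept D (a lambda sigma (X, x))
  (TCons (enc e) (TCons (TCons (enc x) TNil) (TCons v (enc e))))).
rewrite (ex_Pi_receiver (h := h) (pprf_programs dX sX)) => [|eS eR s t];
  last by rewrite ex_ret.
rewrite [X in `|_ - X|](_ : _ = ex (@F_bssPMT R B l _ _ X x) (fun o =>
  ex (dseq (dseq (dflip R) (gamma lambda sigma)) (B lambda sigma))
     (fun t => h o.2 (enc t)))); last first.
  apply: eq_ex => o; rewrite ex_bind SimE.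
  rewrite /third /fifth /= !spine_unary.
  by apply: eq_ex => t; rewrite ex_ret.
rewrite (ex_F_receiver gamma X x h).
(* Both sides average over the same secrets and shares, so it suffices to bound the gap for each
   fixed choice. *)
rewrite -exB; apply: le_trans (ler_norm_ex _ _) _.
rewrite -[leRHS](ex_cst (dprod (fun _ : 'I_(B lambda sigma) =>
  dbits R (gamma lambda sigma)))); apply: ler_ex => s.
rewrite -exB; apply: le_trans (ler_norm_ex _ _) _.
rewrite -[leRHS](ex_cst (dprod (fun _ : 'I_(B lambda sigma) => dflip R))).
apply: ler_ex => e; apply: le_trans (fg _ _ (X, x, s, e) _) => //.
rewrite advantageE le_eqVlt; apply/orP; left; apply/eqP; congr `|_ - _|.
  by apply: eq_ex => u; rewrite /accept TE.
by apply: eq_ex => u; rewrite /accept TE.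
Qed.

End Security.

Theorem theorem1 (R : realType) (B l gamma kappa m : nat -> nat -> nat)
    (B_poly : poly_bounded B) (l_poly : poly_bounded l)
    (gamma_poly : poly_bounded gamma) (kappa_poly : poly_bounded kappa)
    (m_poly : poly_bounded m)
    (B_gt0 : forall lambda sigma, (0 < B lambda sigma)%N)
    (gamma_ge : forall lambda sigma : nat,
       (sigma%:R + ln (B lambda sigma)%:R / ln 2 <= (gamma lambda sigma)%:R :> R))
    (P : pprf_family R B l gamma kappa) (P_pprf : programmable_prf m P) :
  securely_realizes
    (bssPMT_public B l gamma) (@bssPMT_valid m B l)
    (Pi_bssPMT (F_bOPPRF P) (F_ssPEQT R))
    (@F_bssPMT R B l).
Proof.
split; first exact: correctness.
by split; [exact: sender_privacy | exact: receiver_privacy].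
Qed.
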